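(* There exists a natural number $n$ such that both logics $L_\emptyset(\mathsf{H}_n)$ and $L_\emptyset(\mathsf{E}_n)$ are undecidable; that is, the set of sentences of $L_\emptyset(\mathsf{H}_n)$ true in all models (equivalently, the set of satisfiable sentences) is not recursive, and likewise for $L_\emptyset(\mathsf{E}_n)$.
   Context: A Henkin (branching) quantifier prefix is a triple $Q=(A,E,D)$ where $A=\{x_1,\dots,x_n\}$ and $E=\{y_1,\dots,y_k\}$ are disjoint sets of universal and existential variables and $D\subseteq A\times E$ is a dependency relation ($y$ depends on $x$ iff $(x,y)\in D$). Semantics: $M\models Q\varphi(\bar x,\bar y)$ iff there are functions $f_1,\dots,f_k$ on the universe of $M$ such that $(M,f_1,\dots,f_k)\models \forall \bar x\,\varphi(\bar x,f_1(\bar x_1),\dots,f_k(\bar x_k))$, where $\bar x$ lists all universal variables of $Q$ and $\bar x_i$ lists the universal variables on which $y_i$ depends. For a set $\mathcal Q$ of Henkin quantifiers, $L(\mathcal Q)$ is first-order logic with equality extended by the quantifiers in $\mathcal Q$ (closed under the usual connectives and first-order quantifiers), and $L(Q)=L(\{Q\})$; $L_\emptyset$ denotes the version over the empty vocabulary (the only atomic formulas are equalities between variables). $\mathsf{H}_n$ is the quantifier with universal variables $x_1,\dots,x_n$, existential variables $y_1,\dots,y_n$, where each $y_i$ depends only on $x_i$ (written as $n$ rows $\forall x_i\,\exists y_i$). $\mathsf{E}_n$ is the quantifier with universal variables $x_1,x_2$ and existential variables $y_1,\dots,y_n,z_1,\dots,z_n$, where each $y_i$ depends only on $x_1$ and each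 $z_i$ depends only on $x_2$ (two rows $\forall x_1\,\exists y_1\dots y_n$ and $\forall x_2\,\exists z_1\dots z_n$). *)

(* Defs.v *)
From Stdlib Require Import Arith List.
Import ListNotations.

(* Universal variables are indexed 0..hA-1, existential ones 0..hE-1;
   hD i j = true  iff  existential j depends on universal i. *)
Record henkin := Henkin { hA : nat; hE : nat; hD : nat -> nat -> bool }.

Definition Hq (n : nat) : henkin := Henkin n n (fun i j => Nat.eqb i j).

(* E_n : universals x1 (index 0), x2 (index 1); existentials
   y_1..y_n (indices 0..n-1) depend only on x1,
   z_1..z_n (indices n..2n-1) depend only on x2. *)
Definition Eq_ (n : nat) : henkin :=
  Henkin 2 (2 * n) (fun i j => if Nat.ltb j n then Nat.eqb i 0 else Nat.eqb i 1).

(* Variables are natural numbers. The only atomic formulas are equalities.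
   [FQ xs ys phi] is Q applied to phi, binding universal variables xs
   (in order x_1..x_n) and existential variables ys (in order y_1..y_k). *)
Inductive form : Type :=
| FEq  : nat -> nat -> form
| FNeg : form -> form
| FAnd : form -> form -> form
| FEx  : nat -> form -> form
| FQ   : list nat -> list nat -> form -> form.

Fixpoint fv (f : form) : list nat :=
  match f with
  | FEq x y => [x; y]
  | FNeg g => fv g
  | FAnd g h => fv g ++ fv h
  | FEx x g => filter (fun v => negb (Nat.eqb v x)) (fv g)
  | FQ xs ys g =>
      filter (fun v => negb (existsb (Nat.eqb v) (xs ++ ys))) (fv g)
  end.

Fixpoint wf (Q : henkin) (f : form) : Prop :=
  match f with
  | FEq _ _ => True
  | FNeg g => wf Q g
  | FAnd g h => wf Q g /\ wf Q h
  | FEx _ g => wf Q g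
  | FQ xs ys g =>
      length xs = hA Q /\ length ys = hE Q /\ NoDup (xs ++ ys) /\ wf Q g
  end.

Definition sentence (Q : henkin) (f : form) : Prop := wf Q f /\ fv f = [].

Definition upd {M : Type} (rho : nat -> M) (x : nat) (m : M) : nat -> M :=
  fun v => if Nat.eqb v x then m else rho v.

Fixpoint upd_list {M : Type} (rho : nat -> M) (l : list nat) (vals : nat -> M)
  : nat -> M :=
  match l with
  | [] => rho
  | x :: l' => upd (upd_list rho l' (fun k => vals (S k))) x (vals 0)
  end.

(* A model of the empty vocabulary is just a nonempty type M. *)
Fixpoint sat (Q : henkin) (M : Type) (rho : nat -> M) (f : form) : Prop :=
  match f with
  | FEq x y => rho x = rho y
  | FNeg g => ~ sat Q M rho g
  | FAnd g h => sat Q M rho g /\ sat Q M rho h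
  | FEx x g => exists m : M, sat Q M (upd rho x m) g
  | FQ xs ys g =>
      (* there are Skolem functions F j : M^(universals) -> M, with F j
         depending only on the universals i with hD i j, such that
         for every tuple a of values of the universals, g holds. *)
      exists F : nat -> (nat -> M) -> M,
        (forall j (a a' : nat -> M),
            (forall i, i < hA Q -> hD Q i j = true -> a i = a' i) ->
            F j a = F j a') /\
        forall a : nat -> M,
          sat Q M (upd_list (upd_list rho xs a) ys (fun j => F j a)) g
  end.

Definition valid (Q : henkin) (f : form) : Prop :=
  forall (M : Type), inhabited M -> forall rho : nat -> M, sat Q M rho f.

Definition pair (a b : nat) : nat := (a + b) * (a + b + 1) / 2 + b.

Fixpoint code_list (l : list nat) : nat :=
  match l with
  | [] => 0
  | x :: l' => S (pair x (code_list l'))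
  end.

Fixpoint code (f : form) : nat :=
  match f with
  | FEq x y => 5 * pair x y
  | FNeg g => 5 * code g + 1
  | FAnd g h => 5 * pair (code g) (code h) + 2
  | FEx x g => 5 * pair x (code g) + 3
  | FQ xs ys g => 5 * pair (pair (code_list xs) (code_list ys)) (code g) + 4
  end.

Inductive instr : Type :=
| INC : nat -> instr
| DEC : nat -> nat -> instr.

Definition program := list instr.

Definition step (p : program) (pc : nat) (regs : nat -> nat)
  : option (nat * (nat -> nat)) :=
  match nth_error p pc with
  | None => None
  | Some (INC r) =>
      Some (S pc, fun v => if Nat.eqb v r then S (regs v) else regs v)
  | Some (DEC r j) =>
      match regs r with
      | 0 => Some (j, regs)
      | S k => Some (S pc, fun v => if Nat.eqb v r then k else regs v)
      end
  end.

Fixpoint run (p : program) (fuel : nat) (pc : nat) (regs : nat -> nat)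
  : option (nat -> nat) :=
  match step p pc regs with
  | None => Some regs
  | Some (pc', regs') =>
      match fuel with
      | 0 => None
      | S fuel' => run p fuel' pc' regs'
      end
  end.

Definition decides (p : program) (P : nat -> Prop) : Prop :=
  forall x : nat, exists fuel regs,
    run p fuel 0 (fun v => if Nat.eqb v 0 then x else 0) = Some regs /\
    ((P x /\ regs 0 = 1) \/ (~ P x /\ regs 0 = 0)).

Definition recursive (P : nat -> Prop) : Prop := exists p, decides p P.

Definition valid_codes (Q : henkin) (m : nat) : Prop :=
  exists f, sentence Q f /\ code f = m /\ valid Q f.

Definition undecidable (Q : henkin) : Prop := ~ recursive (valid_codes Q).

(* Main.v *)
Require Import Defs.
From Stdlib Require Import Arith List Lia Classical FunctionalExtensionality.
From Stdlib Require Cantor.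
Import ListNotations.

(** A clause over an empty vocabulary can say, of unary functions given by a
    Henkin prefix and of constants quantified outside it, that they describe a
    run of a counter machine: cells stand for a register at an instant, and
    constants for program counters, registers and the input.  All conditions are
    Horn clauses in the values of twelve functions at two points, a form which
    both prefixes express with 24 rows or functions.  Being Horn, they force the
    true run inside every model, so they are contradictory if the machine halts;
    if it does not halt, the run itself gives a model.

    The machine that computes, from the code of its own clauses, the code of the
    sentence refuting them, then asks a supposed decision procedure whether this
    sentence is valid and does the opposite, gives a contradiction. *)

(** * The coding *)

Lemma pair_to_nat (a b : nat) : pair a b = Cantor.to_nat (a, b).
Proof.
  unfold pair. pose proof (Cantor.to_nat_spec a b) as H.
  replace ((a + b) * (a + b + 1)) with ((Cantor.to_nat (a, b) - b) * 2) by nia.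
  rewrite Nat.div_mul by lia. pose proof (Cantor.to_nat_non_decreasing a b). lia.
Qed.

Lemma pair_inj (a b a' b' : nat) : pair a b = pair a' b' -> a = a' /\ b = b'.
Proof.
  rewrite !pair_to_nat. intros H. apply Cantor.to_nat_inj in H.
  injection H; auto.
Qed.

Lemma add_le_pair (a b : nat) : a + b <= pair a b.
Proof.
  rewrite pair_to_nat. pose proof (Cantor.to_nat_non_decreasing a b). lia.
Qed.

Fixpoint triangle (n : nat) : nat :=
  match n with 0 => 0 | S k => S k + triangle k end.

(** Freed of its division, the pairing becomes a sum that nested loops of a counter machine can
    accumulate. *)
Lemma pair_triangle (a b : nat) : pair a b = triangle (b + a) + b.
Proof.
  unfold pair.
  assert (H : forall n, n * (n + 1) = triangle n * 2)
    by (intros n; induction n; simpl triangle; lia).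
  rewrite H, Nat.div_mul by lia. f_equal. f_equal. lia.
Qed.

Lemma code_list_inj (l l' : list nat) : code_list l = code_list l' -> l = l'.
Proof.
  revert l'. induction l as [|x l IH]; intros [|y l']; cbn [code_list];
    try discriminate; auto.
  intros H. apply Nat.succ_inj, pair_inj in H. destruct H as [-> H].
  f_equal; auto.
Qed.

Lemma code_inj (f g : form) : code f = code g -> f = g.
Proof.
  revert g.
  induction f as [x y|f IH|f1 IH1 f2 IH2|x f IH|xs ys f IH];
    intros [x' y'|g|g1 g2|x' g|xs' ys' g]; cbn [code]; intros H; try lia.
  - assert (E : pair x y = pair x' y') by lia.
    apply pair_inj in E. destruct E; congruence.
  - f_equal. apply IH. lia.
  - assert (E : pair (code f1) (code f2) = pair (code g1) (code g2)) by lia.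
    apply pair_inj in E. destruct E. f_equal; auto.
  - assert (E : pair x (code f) = pair x' (code g)) by lia.
    apply pair_inj in E. destruct E. f_equal; auto.
  - assert (E : pair (pair (code_list xs) (code_list ys)) (code f)
                = pair (pair (code_list xs') (code_list ys')) (code g)) by lia.
    apply pair_inj in E. destruct E as [E E'].
    apply pair_inj in E. destruct E. f_equal; auto using code_list_inj.
Qed.

(** Pairing dominates addition, so codes bound variables. Hence a block of [a + 74] quantifiers with
    [a = code C] binds every free variable of [C], and the encoder need not inspect [C]. *)
Lemma fv_le_code (f : form) (v : nat) : In v (fv f) -> v <= code f.
Proof.
  induction f as [x y|f IH|f1 IH1 f2 IH2|x f IH|xs ys f IH]; cbn [fv code].
  - pose proof (add_le_pair x y). intros [<-|[<-|[]]]; lia.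
  - intros H. specialize (IH H). lia.
  - pose proof (add_le_pair (code f1) (code f2)).
    intros H'. apply in_app_or in H'. destruct H' as [H'|H'];
      [specialize (IH1 H')|specialize (IH2 H')]; lia.
  - pose proof (add_le_pair x (code f)).
    intros H'. apply filter_In in H'. specialize (IH (proj1 H')). lia.
  - pose proof (add_le_pair (pair (code_list xs) (code_list ys)) (code f)).
    intros H'. apply filter_In in H'. specialize (IH (proj1 H')). lia.
Qed.

(** * Counter machines *)

Definition config := (nat * (nat -> nat))%type.

(** Steps are counted because instants of the run are later matched with iterates of [fN]. *)
Inductive reach (p : program) (c : config) : nat -> config -> Prop :=
| reach_refl : reach p c 0 c
| reach_step t pc regs c' :
    reach p c t (pc, regs) -> step p pc regs = Some c' -> reach p c (S t) c'.

Definition star (p : program) (c c' : config) : Prop := exists t, reach p c t c'.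

Definition halting (p : program) (c : config) : Prop :=
  exists pc regs, star p c (pc, regs) /\ step p pc regs = None.

Lemma star_refl p c : star p c c.
Proof. exists 0. constructor. Qed.

Lemma star_trans p c c' c'' : star p c c' -> star p c' c'' -> star p c c''.
Proof.
  intros [t H] [t' H']. induction H' as [|t' pc regs c'' _ [s IH] E].
  - now exists t.
  - exists (S s). econstructor; eauto.
Qed.

Lemma star_step p pc regs c : step p pc regs = Some c -> star p (pc, regs) c.
Proof. intros H. exists 1. econstructor; [constructor|exact H]. Qed.

Lemma run_reach p fuel pc regs regs' :
  run p fuel pc regs = Some regs' ->
  exists pc', star p (pc, regs) (pc', regs') /\ step p pc' regs' = None.
Proof.
  revert pc regs. induction fuel as [|fuel IH]; intros pc regs; cbn [run];
    destruct (step p pc regs) as [[pc1 regs1]|] eqn:E; try discriminate.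
  - intros [= <-]. exists pc. split; [apply star_refl|exact E].
  - intros H. apply IH in H. destruct H as (pc' & H & H').
    exists pc'. split; [|exact H'].
    eapply star_trans; [apply star_step, E|exact H].
  - intros [= <-]. exists pc. split; [apply star_refl|exact E].
Qed.

Lemma step_None p pc regs : step p pc regs = None <-> length p <= pc.
Proof.
  rewrite <- nth_error_None. unfold step.
  destruct (nth_error p pc) as [[r|r j]|]; [| |easy]; split; try discriminate.
  destruct (regs r); discriminate.
Qed.

Definition occurs_at (p : program) (off : nat) (q : program) : Prop :=
  exists pre post, p = pre ++ q ++ post /\ length pre = off.

Lemma occurs_at_app p off q q' :
  occurs_at p off (q ++ q') ->
  occurs_at p off q /\ occurs_at p (off + length q) q'.
Proof.
  intros (pre & post & -> & <-). split.
  - exists pre, (q' ++ post). now rewrite <- app_assoc.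
  - exists (pre ++ q), post. now rewrite length_app, <- !app_assoc.
Qed.

Lemma occurs_at_nth p off q i :
  occurs_at p off q -> i < length q -> nth_error p (off + i) = nth_error q i.
Proof.
  intros (pre & post & -> & <-) Hi.
  rewrite nth_error_app2 by lia. rewrite nth_error_app1 by lia.
  f_equal. lia.
Qed.

Lemma occurs_at_cons p off ins q :
  occurs_at p off (ins :: q) ->
  nth_error p off = Some ins /\ occurs_at p (S off) q.
Proof.
  intros H. split.
  - rewrite <- (Nat.add_0_r off). rewrite (occurs_at_nth _ _ _ 0 H); simpl; auto; lia.
  - apply (occurs_at_app p off [ins] q) in H. rewrite <- Nat.add_1_r. apply H.
Qed.

(** * A structured language *)

(* [CFor r c] is [while r <> 0 do (r := r - 1; c)]; [c] may change [r].  Its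
   compilation jumps back by decrementing register 1, which must stay [0]. *)
Inductive cmd : Type :=
| CAdd : nat -> nat -> cmd
| CSeq : cmd -> cmd -> cmd
| CFor : nat -> cmd -> cmd.

(** Jump targets are absolute, hence the offset. A loop exits to [off + length q + 2], just past its
    closing [DEC 1 off]. *)
Fixpoint compile (off : nat) (c : cmd) : program :=
  match c with
  | CAdd r k => repeat (INC r) k
  | CSeq c1 c2 =>
      let q := compile off c1 in q ++ compile (off + length q) c2
  | CFor r c1 =>
      let q := compile (S off) c1 in
      DEC r (off + length q + 2) :: q ++ [DEC 1 off]
  end.

(** Finite lists stand for register files that are zero beyond their end, so writing past the end
    pads with zeros. *)
Fixpoint set (l : list nat) (r v : nat) : list nat :=
  match l, r with
  | [], 0 => [v]
  | [], S r' => 0 :: set [] r' v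
  | _ :: l', 0 => v :: l'
  | x :: l', S r' => x :: set l' r' v
  end.

Lemma nth_set l r v i :
  nth i (set l r v) 0 = if Nat.eqb i r then v else nth i l 0.
Proof.
  revert l i. induction r as [|r IH]; intros [|x l] [|i]; simpl; auto.
  - now destruct i.
  - rewrite IH. now destruct (Nat.eqb i r), i.
Qed.

Lemma length_set l r v : r < length l -> length (set l r v) = length l.
Proof.
  revert l. induction r as [|r IH]; intros [|x l]; simpl; try lia.
  intros H. rewrite IH; lia.
Qed.

Definition regs_of (l : list nat) : nat -> nat := fun v => nth v l 0.

Lemma regs_of_set l r v :
  regs_of (set l r v) = fun i => if Nat.eqb i r then v else regs_of l i.
Proof. apply functional_extensionality. intros i. apply nth_set. Qed.

Inductive exec : cmd -> list nat -> list nat -> Prop :=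
| exec_add r k l : r <> 1 -> exec (CAdd r k) l (set l r (nth r l 0 + k))
| exec_seq c1 c2 l l1 l2 :
    exec c1 l l1 -> exec c2 l1 l2 -> exec (CSeq c1 c2) l l2
| exec_for_0 r c l : nth r l 0 = 0 -> exec (CFor r c) l l
| exec_for_S r c l l1 l2 k :
    nth r l 0 = S k -> exec c (set l r k) l1 -> exec (CFor r c) l1 l2 ->
    exec (CFor r c) l l2.

Lemma star_repeat_INC p off r k regs :
  occurs_at p off (repeat (INC r) k) ->
  star p (off, regs)
    (off + k, fun i => if Nat.eqb i r then regs r + k else regs i).
Proof.
  revert off regs. induction k as [|k IH]; intros off regs H.
  - replace (fun i => if Nat.eqb i r then regs r + 0 else regs i) with regs.
    + rewrite Nat.add_0_r. apply star_refl.
    + apply functional_extensionality. intros i.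
      destruct (Nat.eqb_spec i r); subst; lia.
  - apply occurs_at_cons in H. destruct H as [E H].
    eapply star_trans.
    + apply star_step. unfold step. rewrite E. reflexivity.
    + replace (off + S k) with (S off + k) by lia.
      match goal with |- star _ (_, ?s) (_, ?s') =>
        replace s' with (fun i => if Nat.eqb i r then s r + k else s i) end.
      * apply IH, H.
      * apply functional_extensionality. intros i. simpl.
        rewrite Nat.eqb_refl. destruct (Nat.eqb i r); lia.
Qed.

Lemma exec_zero_reg c l l' : exec c l l' -> nth 1 l 0 = 0 -> nth 1 l' 0 = 0.
Proof.
  induction 1 as [r k l Hr|c1 c2 l l1 l2 _ IH1 _ IH2|r c l _
                 |r c l l1 l2 k E _ IH1 _ IH2]; intros Z; auto.
  - rewrite nth_set. destruct (Nat.eqb_spec 1 r); congruence.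
  - apply IH2, IH1. rewrite nth_set. destruct (Nat.eqb_spec 1 r); congruence.
Qed.

Lemma compile_correct c l l' :
  exec c l l' -> nth 1 l 0 = 0 ->
  forall p off, occurs_at p off (compile off c) ->
  star p (off, regs_of l) (off + length (compile off c), regs_of l').
Proof.
  induction 1 as [r k l Hr|c1 c2 l l1 l2 H1 IH1 H2 IH2|r c l E
                 |r c l l1 l2 k E H1 IH1 H2 IH2]; intros Z p off H;
    cbn [compile] in *.
  - rewrite repeat_length, regs_of_set. now apply (star_repeat_INC p off r k (regs_of l)).
  - apply occurs_at_app in H. destruct H as [Ha Hb].
    rewrite length_app, Nat.add_assoc.
    eapply star_trans; [apply IH1; assumption|].
    apply IH2; [eapply exec_zero_reg; eassumption|assumption].
  - apply occurs_at_cons in H. destruct H as [Ea _].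
    apply star_step. unfold step. rewrite Ea. unfold regs_of at 1. rewrite E.
    f_equal. f_equal. cbn [length]. rewrite length_app. cbn [length]. lia.
  - assert (Z' : nth 1 (set l r k) 0 = 0)
      by (rewrite nth_set; destruct (Nat.eqb_spec 1 r); congruence).
    assert (Z1 : nth 1 l1 0 = 0) by (eapply exec_zero_reg; eassumption).
    (* The remaining rounds are the same loop at the same offset, so this hypothesis is used before
       the code is split. *)
    specialize (IH2 Z1 p off H). eapply star_trans; [|exact IH2].
    apply occurs_at_cons in H. destruct H as [Ea Hb].
    apply occurs_at_app in Hb. destruct Hb as [Hb Hc].
    apply occurs_at_cons in Hc. destruct Hc as [Ec _].
    eapply star_trans.
    { apply star_step. unfold step. rewrite Ea. unfold regs_of at 1. rewrite E.
      rewrite <- regs_of_set. reflexivity. }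
    eapply star_trans; [apply IH1; assumption|].
    apply star_step. unfold step. rewrite Ec. unfold regs_of at 1. rewrite Z1.
    reflexivity.
Qed.

Lemma exec_for_count r c n (st : nat -> list nat) :
  (forall i, i <= n -> nth r (st i) 0 = n - i) ->
  (forall i, i < n -> exec c (set (st i) r (n - S i)) (st (S i))) ->
  exec (CFor r c) (st 0) (st n).
Proof.
  intros Hr Hc.
  (* Induction on the number of rounds left, since [exec] unfolds a loop from its first round. *)
  assert (H : forall m, m <= n -> exec (CFor r c) (st (n - m)) (st n)).
  { induction m as [|m IH]; intros Hm.
    - rewrite Nat.sub_0_r. apply exec_for_0. rewrite Hr; lia.
    - apply exec_for_S with (l1 := st (n - m)) (k := m).
      + rewrite Hr; lia.
      + replace (n - m) with (S (n - S m)) by lia.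
        replace m with (n - S (n - S m)) at 2 by lia. apply Hc. lia.
      + apply IH. lia. }
  rewrite <- (Nat.sub_diag n) at 1. now apply H.
Qed.

Lemma exec_eq c l l1 l2 : exec c l l1 -> l1 = l2 -> exec c l l2.
Proof. now intros H <-. Qed.

Lemma set_ext l l' :
  length l = length l' -> (forall i, nth i l 0 = nth i l' 0) -> l = l'.
Proof. intros H H'. now apply nth_ext with 0 0. Qed.

Ltac lengths := first [assumption | reflexivity | rewrite length_set by lengths; lengths].

Ltac set_lists :=
  apply set_ext; [lengths|];
  let i := fresh "i" in intros i; rewrite !nth_set;
  repeat match goal with
  | |- context [Nat.eqb ?a ?b] => destruct (Nat.eqb_spec a b); subst
  end; try lia.

(** * Arithmetic routines *)

Lemma exec_move r s l :
  r < length l -> s < length l -> r <> s -> s <> 1 ->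
  exec (CFor r (CAdd s 1)) l (set (set l s (nth s l 0 + nth r l 0)) r 0).
Proof.
  intros Hr Hs Hrs H1. remember (nth r l 0) as n eqn:E. revert l E Hr Hs.
  induction n as [|n IH]; intros l E Hr Hs.
  - eapply exec_eq; [now apply exec_for_0|]. set_lists.
  - eapply exec_for_S; [symmetry; exact E|now constructor|].
    eapply exec_eq; [apply IH|].
    + rewrite !nth_set. destruct (Nat.eqb_spec r s); [lia|].
      now rewrite Nat.eqb_refl.
    + lengths.
    + lengths.
    + set_lists.
Qed.

Lemma exec_move2 r s t l :
  r < length l -> s < length l -> t < length l ->
  r <> s -> r <> t -> s <> t -> s <> 1 -> t <> 1 ->
  exec (CFor r (CSeq (CAdd s 1) (CAdd t 1))) l
    (set (set (set l s (nth s l 0 + nth r l 0)) t (nth t l 0 + nth r l 0)) r 0).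
Proof.
  intros Hr Hs Ht Hrs Hrt Hst Hs1 Ht1.
  remember (nth r l 0) as n eqn:E. revert l E Hr Hs Ht.
  induction n as [|n IH]; intros l E Hr Hs Ht.
  - eapply exec_eq; [now apply exec_for_0|]. set_lists.
  - eapply exec_for_S; [symmetry; exact E|econstructor; now constructor|].
    eapply exec_eq; [apply IH|].
    + rewrite !nth_set.
      destruct (Nat.eqb_spec r s); [lia|]. destruct (Nat.eqb_spec r t); [lia|].
      now rewrite Nat.eqb_refl.
    + lengths.
    + lengths.
    + lengths.
    + set_lists.
Qed.

(** Arguments in registers 2 and 3, result in 3. Register 4 runs down from their sum; each round
    adds its value before the decrement to register 3, which accumulates the triangular number.
    Registers 2 and 5 only save values. *)
Definition PAIR : cmd :=
  CSeq (CFor 3 (CSeq (CAdd 4 1) (CAdd 5 1)))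
 (CSeq (CFor 2 (CAdd 4 1))
 (CSeq (CFor 5 (CAdd 3 1))
       (CFor 4 (CSeq (CAdd 3 1)
               (CSeq (CFor 4 (CSeq (CAdd 2 1) (CAdd 3 1)))
                     (CFor 2 (CAdd 4 1))))))).

Definition AFFINE (k : nat) : cmd :=
  CSeq (CFor 3 (CAdd 4 5)) (CSeq (CFor 4 (CAdd 3 1)) (CAdd 3 k)).

Definition COPY (r s : nat) : cmd :=
  CSeq (CFor r (CSeq (CAdd s 1) (CAdd 4 1))) (CFor 4 (CAdd r 1)).

Ltac list_eq := repeat (apply (f_equal2 (@cons nat)); [lia|]); reflexivity.

Ltac exec_simple :=
  repeat (cbn [set nth];
    first
    [ eapply exec_seq
    | eapply exec_add; discriminate
    | eapply exec_move; cbn [length]; lia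
    | eapply exec_move2; cbn [length]; lia ]);
  cbn [set nth].

Lemma exec_triangle o x a i j w t y :
  x = 0 ->
  exec (CFor 4 (CSeq (CAdd 3 1)
               (CSeq (CFor 4 (CSeq (CAdd 2 1) (CAdd 3 1)))
                     (CFor 2 (CAdd 4 1)))))
    [o; 0; x; y; t; 0; a; i; j; w] [o; 0; 0; triangle t + y; 0; 0; a; i; j; w].
Proof.
  intros ->. revert y. induction t as [|t IH]; intros y.
  - now apply exec_for_0.
  - eapply exec_for_S; [reflexivity| |].
    + cbn [set nth]. exec_simple.
    + cbn [set nth]. rewrite !Nat.add_0_l.
      eapply exec_eq; [apply IH|]. cbn [triangle]. list_eq.
Qed.

Lemma exec_PAIR o x y a i j w :
  exec PAIR [o; 0; x; y; 0; 0; a; i; j; w]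
            [o; 0; 0; pair x y; 0; 0; a; i; j; w].
Proof.
  unfold PAIR.
  eapply exec_seq; [exec_simple|]. cbn [set nth].
  eapply exec_seq; [exec_simple|]. cbn [set nth].
  eapply exec_seq; [exec_simple|]. cbn [set nth].
  rewrite !Nat.add_0_l.
  eapply exec_eq; [now apply exec_triangle|].
  now rewrite pair_triangle.
Qed.

Lemma exec_AFFINE o y a i j w k :
  exec (AFFINE k) [o; 0; 0; y; 0; 0; a; i; j; w]
                  [o; 0; 0; 5 * y + k; 0; 0; a; i; j; w].
Proof.
  unfold AFFINE. eapply exec_seq.
  { rewrite <- (Nat.sub_0_r y) at 1.
    apply (exec_for_count 3 (CAdd 4 5) y
             (fun m => [o; 0; 0; y - m; 5 * m; 0; a; i; j; w])).
    - reflexivity.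
    - intros m Hm. eapply exec_eq; [now constructor|]. cbn [set nth].
      list_eq. }
  eapply exec_eq; [exec_simple|]. cbn [set nth]. list_eq.
Qed.

(** The constant [k] is the constructor tag in [code]: 0 for [FEq], 2 for [FAnd], 3 for [FEx], 4 for
    [FQ]. The unary [FNeg] is [AFFINE 1] alone. *)
Definition NODE (k : nat) : cmd := CSeq PAIR (AFFINE k).

Lemma exec_NODE o x y a i j w k :
  exec (NODE k) [o; 0; x; y; 0; 0; a; i; j; w]
                [o; 0; 0; 5 * pair x y + k; 0; 0; a; i; j; w].
Proof. eapply exec_seq; [apply exec_PAIR|apply exec_AFFINE]. Qed.

Ltac exec_all :=
  repeat (cbn [set nth]; rewrite ?Nat.add_0_l;
    first
    [ apply exec_NODE | apply exec_AFFINE | eapply exec_seq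
    | eapply exec_add; discriminate
    | eapply exec_move; cbn [length]; lia
    | eapply exec_move2; cbn [length]; lia ]);
  cbn [set nth].

(** * The sentences *)

Definition imp (f g : form) : form := FNeg (FAnd f (FNeg g)).

Fixpoint conj (l : list form) : form :=
  match l with [] => FEq 0 0 | f :: l' => FAnd f (conj l') end.

(* [X1], [X2] are two points, [Y1 i], [Y2 i] the values of the [i]-th function
   there; the variables below 72 are reserved for the Henkin prefix. *)
Definition X1 : nat := 0.
Definition X2 : nat := 12.
Definition Y1 (i : nat) : nat := 24 + i.
Definition Y2 (i : nat) : nat := 36 + i.
Definition L : nat := 72.
Definition D (i : nat) : nat := 73 + i.

(** The input enters through [L] only: it is the end of a chain of successors [D 0], ..., [D a]. The
    machine clauses thus do not depend on the input, and their own code can serve as input. The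
    recursion on [i] matches a loop of the encoder. *)
Fixpoint numeral (a i : nat) : form :=
  match i with
  | 0 => FEq L (D a)
  | S i' => FAnd (imp (FEq X1 (D i')) (FEq (Y1 0) (D (S i')))) (numeral a i')
  end.

Fixpoint FExs (n : nat) (f : form) : form :=
  match n with 0 => f | S n' => FEx n' (FExs n' f) end.

(** The variables [L], [D 0], ..., [D a] all lie below [a + 74]. The conjunct [glue] constrains all
    tuples of universals, while [link] selects those that represent two points. *)
Definition query (xs ys : list nat) (glue link C : form) (a : nat) : form :=
  FExs (a + 74)
    (FQ xs ys (FAnd glue (imp link (FAnd C (numeral a a))))).

(** * Computing the code of a sentence *)

(* Register 0 holds the input and the output, 1 stays zero, 2 and 3 are the
   arguments of [pair], 4 and 5 are scratch, 6 is a copy of the input, 7 and 8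
   count upwards and downwards, 9 saves an accumulator. *)
Definition NUMERAL_STEP : cmd :=
  CSeq (CFor 3 (CAdd 9 1)) (CSeq (COPY 7 3) (CSeq (CAdd 3 74) (CSeq (CAdd 2 24)
 (CSeq (NODE 0) (CSeq (AFFINE 1) (CSeq (CFor 3 (CAdd 0 1)) (CSeq (COPY 7 3)
 (CSeq (CAdd 3 73) (CSeq (NODE 0) (CSeq (CFor 3 (CAdd 2 1))
 (CSeq (CFor 0 (CAdd 3 1)) (CSeq (NODE 2) (CSeq (AFFINE 1)
 (CSeq (CFor 3 (CAdd 2 1)) (CSeq (CFor 9 (CAdd 3 1)) (CSeq (NODE 2)
 (CAdd 7 1))))))))))))))))).

(** As [imp] is a negated conjunction, the negated conclusion is built first and waits in register 0
    until the premise has been moved to register 2. *)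
Lemma exec_NUMERAL_STEP a i j :
  exec NUMERAL_STEP
    [0; 0; 0; code (numeral a i); 0; 0; a; i; j; 0]
    [0; 0; 0; code (numeral a (S i)); 0; 0; a; S i; j; 0].
Proof.
  unfold NUMERAL_STEP, COPY. eapply exec_eq; [exec_all|].
  cbn [set nth numeral code imp]. unfold imp, D. cbn [code].
  rewrite (Nat.add_comm 73 i), (Nat.add_comm 73 (S i)), !Nat.add_0_r.
  replace (S i + 73) with (i + 74) by lia. rewrite (Nat.add_comm i 1).
  reflexivity.
Qed.

Lemma exec_NUMERAL a :
  exec (CFor 8 NUMERAL_STEP)
    [0; 0; 0; code (numeral a 0); 0; 0; a; 0; a; 0]
    [0; 0; 0; code (numeral a a); 0; 0; a; a; 0; 0].
Proof.
  pose proof (exec_for_count 8 NUMERAL_STEP a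
    (fun i => [0; 0; 0; code (numeral a i); 0; 0; a; i; a - i; 0])) as H.
  cbv beta in H. rewrite Nat.sub_0_r, Nat.sub_diag in H. apply H.
  - reflexivity.
  - intros i _. apply exec_NUMERAL_STEP.
Qed.

Definition PREFIX_STEP : cmd := CSeq (COPY 7 2) (CSeq (NODE 3) (CAdd 7 1)).

Lemma exec_PREFIX f n :
  exec (CFor 8 PREFIX_STEP)
    [0; 0; 0; code (FExs 0 f); 0; 0; 0; 0; n; 0]
    [0; 0; 0; code (FExs n f); 0; 0; 0; n; 0; 0].
Proof.
  pose proof (exec_for_count 8 PREFIX_STEP n
    (fun i => [0; 0; 0; code (FExs i f); 0; 0; 0; i; n - i; 0])) as H.
  cbv beta in H. rewrite Nat.sub_0_r, Nat.sub_diag in H. apply H.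
  - reflexivity.
  - intros i _. unfold PREFIX_STEP, COPY. eapply exec_eq; [exec_all|].
    cbn [set nth FExs code]. rewrite (Nat.add_comm i 1). reflexivity.
Qed.

(** The input is used twice, as the number [a] of the numeral and as the code of [C]: this is the
    diagonal substitution. The codes of the quantifier variables, of [glue] and of [link] are
    constants of the program. *)
Definition ENCODE (quant glue link : nat) : cmd :=
  CSeq (CFor 0 (CSeq (CAdd 6 1) (CAdd 8 1)))
 (CSeq (COPY 6 3) (CSeq (CAdd 3 73) (CSeq (CAdd 2 72) (CSeq (NODE 0)
 (CSeq (CFor 8 NUMERAL_STEP)
 (CSeq (CFor 6 (CAdd 2 1)) (CSeq (NODE 2) (CSeq (AFFINE 1)
 (CSeq (CAdd 2 link) (CSeq (NODE 2) (CSeq (AFFINE 1)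
 (CSeq (CAdd 2 glue) (CSeq (NODE 2) (CSeq (CAdd 2 quant) (CSeq (NODE 4)
 (CSeq (CFor 7 (CAdd 8 1)) (CSeq (CAdd 8 74)
 (CSeq (CFor 8 PREFIX_STEP)
 (CSeq (CFor 7 (CAdd 7 0)) (CSeq (AFFINE 1) (CFor 3 (CAdd 0 1)))))))))))))))))))))).

Lemma exec_clear l r :
  r < length l -> r <> 1 -> exec (CFor r (CAdd r 0)) l (set l r 0).
Proof.
  intros Hr H1. remember (nth r l 0) as n eqn:E. revert l E Hr.
  induction n as [|n IH]; intros l E Hr.
  - eapply exec_eq; [now apply exec_for_0|]. set_lists.
  - eapply exec_for_S; [symmetry; exact E|now constructor|].
    eapply exec_eq; [apply IH|].
    + rewrite !nth_set, Nat.eqb_refl. lia.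
    + lengths.
    + set_lists.
Qed.

Lemma exec_ENCODE xs ys glue link C :
  exec (ENCODE (pair (code_list xs) (code_list ys)) (code glue) (code link))
    [code C; 0; 0; 0; 0; 0; 0; 0; 0; 0]
    [code (FNeg (query xs ys glue link C (code C))); 0; 0; 0; 0; 0; 0; 0; 0; 0].
Proof.
  set (a := code C).
  unfold ENCODE, COPY.
  do 5 (eapply exec_seq; [exec_all|]; cbn [set nth]; rewrite ?Nat.add_0_l).
  eapply exec_seq.
  { replace (5 * pair 72 (a + 73) + 0) with (code (numeral a 0))
      by (cbn [numeral code]; unfold D; rewrite (Nat.add_comm a 73); symmetry; apply Nat.add_0_r).
    apply exec_NUMERAL. }
  (* The commands between the two loops assemble the [FQ] formula and load [a + 74] into the
     counter. *)
  do 12 (eapply exec_seq; [exec_all|]; cbn [set nth]; rewrite ?Nat.add_0_l).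
  eapply exec_seq; [apply (exec_PREFIX (FQ xs ys
    (FAnd glue (imp link (FAnd C (numeral a a))))) (a + 74))|].
  eapply exec_seq; [apply exec_clear; cbn [length]; lia|]. cbn [set nth].
  eapply exec_eq; [exec_all|]. reflexivity.
Qed.

(** * Satisfaction *)

Lemma sat_imp Q M (rho : nat -> M) f g :
  sat Q M rho (imp f g) <-> (sat Q M rho f -> sat Q M rho g).
Proof. cbn [sat imp]. tauto. Qed.

Lemma sat_conj Q M (rho : nat -> M) l :
  sat Q M rho (conj l) <-> forall f, In f l -> sat Q M rho f.
Proof.
  induction l as [|f l IH]; cbn [sat conj In].
  - easy.
  - rewrite IH. split.
    + intros [Hf Hl] g [<-|Hg]; auto.
    + intros H. split; auto.
Qed.

Definition clause (prem : list (nat * nat)) (concl : form) : form :=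
  fold_right (fun e g => imp (FEq (fst e) (snd e)) g) concl prem.

Lemma sat_FExs_elim Q M n f (rho : nat -> M) :
  sat Q M rho (FExs n f) -> exists rho', sat Q M rho' f.
Proof.
  revert rho. induction n as [|n IH]; intros rho; cbn [FExs sat].
  - eauto.
  - intros [m H]. eauto.
Qed.

Lemma sat_FExs_intro Q M n f (e rho : nat -> M) :
  (forall rho', (forall v, v < n -> rho' v = e v) ->
     (forall v, n <= v -> rho' v = rho v) -> sat Q M rho' f) ->
  sat Q M rho (FExs n f).
Proof.
  revert rho. induction n as [|n IH]; intros rho H; cbn [FExs sat].
  - apply H; [lia|auto].
  - exists (e n). apply IH. intros rho' H1 H2. apply H.
    + intros v Hv. destruct (Nat.eq_dec v n) as [->|].
      * rewrite H2 by lia. unfold upd. now rewrite Nat.eqb_refl.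
      * apply H1. lia.
    + intros v Hv. rewrite H2 by lia. unfold upd.
      destruct (Nat.eqb_spec v n); [lia|easy].
Qed.

Lemma fv_FExs n f v : In v (fv (FExs n f)) -> In v (fv f) /\ n <= v.
Proof.
  induction n as [|n IH]; cbn [FExs fv].
  - split; [easy|lia].
  - rewrite filter_In. intros [H H']. destruct (IH H) as [H1 H2].
    split; [easy|]. destruct (Nat.eqb_spec v n); [easy|lia].
Qed.

Lemma fv_numeral a i v : i <= a -> In v (fv (numeral a i)) -> v < a + 74.
Proof.
  induction i as [|i IH]; intros Hi; cbn [numeral fv imp app In];
    unfold L, D, X1, Y1.
  - lia.
  - specialize (IH ltac:(lia)). unfold D in *.
    intros [<-|[<-|[<-|[<-|H]]]]; auto; lia.
Qed.

Lemma wf_FExs Q n f : wf Q f -> wf Q (FExs n f).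
Proof. induction n; cbn; auto. Qed.

Lemma wf_numeral Q a i : wf Q (numeral a i).
Proof. induction i; cbn; tauto. Qed.

(** Variables 48 to 71 are left unconstrained; [E_ys] places there the functions beyond the first
    twelve of each row. *)
Definition good_env {M : Type} (f : nat -> M -> M) (x1 x2 : M)
    (rho rho' : nat -> M) : Prop :=
  rho' X1 = x1 /\ rho' X2 = x2 /\
  (forall i, i < 12 -> rho' (Y1 i) = f i x1) /\
  (forall i, i < 12 -> rho' (Y2 i) = f i x2) /\
  (forall v, 72 <= v -> rho' v = rho v).

(** The only interface to the quantifiers: the prefix says that twelve unary functions exist such
    that [phi] holds at every pair of points. The rest of the argument treats both quantifiers
    uniformly. *)
Record two_point_prefix (Q : henkin) (xs ys : list nat) (glue link : form)
    : Prop := {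
  prefix_wf : wf Q (FQ xs ys (FAnd glue link));
  prefix_fv : forall v, In v (fv (FAnd glue link)) -> v < 72;
  prefix_elim : forall (M : Type) (rho : nat -> M) phi,
    sat Q M rho (FQ xs ys (FAnd glue (imp link phi))) ->
    exists f, forall x1 x2, exists rho',
      good_env f x1 x2 rho rho' /\ sat Q M rho' phi;
  prefix_intro : forall (M : Type) (rho : nat -> M) f phi,
    (forall x1 x2 rho', good_env f x1 x2 rho rho' -> sat Q M rho' phi) ->
    sat Q M rho (FQ xs ys (FAnd glue (imp link phi)))
}.

Lemma sentence_query Q xs ys glue link C :
  two_point_prefix Q xs ys glue link -> wf Q C ->
  sentence Q (FNeg (query xs ys glue link C (code C))).
Proof.
  intros P HC. pose proof (prefix_wf _ _ _ _ _ P) as W. cbn [wf] in W.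
  split.
  - cbn [wf]. apply wf_FExs. cbn [wf imp].
    pose proof (wf_numeral Q (code C) (code C)). tauto.
  - cbn [fv]. destruct (fv (query _ _ _ _ _ _)) as [|v l] eqn:E; [easy|].
    exfalso. assert (Hv : In v (v :: l)) by now left.
    rewrite <- E in Hv. apply fv_FExs in Hv. destruct Hv as [Hv Hn].
    cbn [fv] in Hv. apply filter_In in Hv. destruct Hv as [Hv _].
    unfold imp in Hv. cbn [fv] in Hv. rewrite !in_app_iff in Hv.
    pose proof (prefix_fv _ _ _ _ _ P v) as F. cbn [fv] in F.
    rewrite in_app_iff in F.
    pose proof (fv_le_code C v). pose proof (fv_numeral (code C) (code C) v (le_n _)).
    assert (v < code C + 74); [|lia].
    destruct Hv as [Hv|[Hv|[Hv|Hv]]]; intuition lia.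
Qed.

(** * The two prefixes *)

Lemma upd_eq {M : Type} (rho : nat -> M) x m : upd rho x m x = m.
Proof. unfold upd. now rewrite Nat.eqb_refl. Qed.

Lemma upd_list_notin {M : Type} (rho : nat -> M) l vals v :
  ~ In v l -> upd_list rho l vals v = rho v.
Proof.
  revert vals. induction l as [|x l IH]; intros vals H; [easy|].
  cbn [upd_list]. unfold upd. destruct (Nat.eqb_spec v x) as [->|].
  - destruct H. now left.
  - apply IH. intros H'. apply H. now right.
Qed.

Lemma upd_list_nth {M : Type} (rho : nat -> M) l vals i v :
  NoDup l -> nth_error l i = Some v -> upd_list rho l vals v = vals i.
Proof.
  intros N. revert vals i. induction N as [|x l Hx N IH]; intros vals [|i];
    try discriminate; cbn [nth_error upd_list].
  - intros [= ->]. apply upd_eq.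
  - intros H. unfold upd. destruct (Nat.eqb_spec v x) as [->|].
    + destruct Hx. now apply nth_error_In in H.
    + now rewrite IH with (i := i).
Qed.

(** Rows [i] and [12 + i] carry two copies of the same function. [H_glue] identifies the copies;
    [H_link] restricts to tuples that are constant on the first twelve and on the last twelve
    rows. *)
Definition H_xs := seq 0 24.
Definition H_ys := seq 24 24.
Definition H_glue : form :=
  conj (map (fun i => imp (FEq i (12 + i)) (FEq (Y1 i) (Y2 i))) (seq 0 12)).
Definition H_link : form :=
  conj (map (fun i => FAnd (FEq i X1) (FEq (12 + i) X2)) (seq 0 12)).

Lemma upd_list_seq {M : Type} (rho : nat -> M) a n vals i :
  i < n -> upd_list rho (seq a n) vals (a + i) = vals i.
Proof.
  intros Hi. apply upd_list_nth; [apply seq_NoDup|].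
  rewrite nth_error_nth' with (d := 0); rewrite ?length_seq; auto.
  now rewrite seq_nth.
Qed.

Lemma upd_list_seq_out {M : Type} (rho : nat -> M) a n vals v :
  v < a \/ a + n <= v -> upd_list rho (seq a n) vals v = rho v.
Proof. intros H. apply upd_list_notin. rewrite in_seq. lia. Qed.

Lemma H_prefix : two_point_prefix (Hq 24) H_xs H_ys H_glue H_link.
Proof.
  set (env := fun (M : Type) (rho : nat -> M) a b =>
    upd_list (upd_list rho H_xs a) H_ys b).
  assert (Ex : forall M (rho : nat -> M) a b i, i < 24 -> env M rho a b i = a i).
  { intros M rho a b i Hi. unfold env, H_ys, H_xs.
    rewrite upd_list_seq_out by lia. now apply (upd_list_seq rho 0 24 a i). }
  assert (Ey : forall M (rho : nat -> M) a b i, i < 24 ->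
            env M rho a b (24 + i) = b i).
  { intros M rho a b i Hi. unfold env, H_ys. now apply upd_list_seq. }
  assert (Eo : forall M (rho : nat -> M) a b v, 48 <= v -> env M rho a b v = rho v).
  { intros M rho a b v Hv. unfold env, H_ys, H_xs.
    now rewrite !upd_list_seq_out by lia. }
  assert (Eglue : forall M (rho : nat -> M) a b,
    sat (Hq 24) M (env M rho a b) H_glue <->
    forall i, i < 12 -> a i = a (12 + i) -> b i = b (12 + i)).
  { intros M rho a b. unfold H_glue. rewrite sat_conj. split.
    - intros H i Hi.
      specialize (H _ (in_map _ _ i (proj2 (in_seq 12 0 i) ltac:(lia)))).
      rewrite sat_imp in H. cbn [sat] in H. rewrite !Ex in H by lia.
      unfold Y1, Y2 in H. change (36 + i) with (24 + (12 + i)) in H.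
      rewrite !Ey in H by lia. exact H.
    - intros H f Hf. apply in_map_iff in Hf. destruct Hf as (i & <- & Hi).
      apply in_seq in Hi. rewrite sat_imp. cbn [sat]. rewrite !Ex by lia.
      unfold Y1, Y2. change (36 + i) with (24 + (12 + i)).
      rewrite !Ey by lia. apply H. lia. }
  assert (Elink : forall M (rho : nat -> M) a b,
    sat (Hq 24) M (env M rho a b) H_link <->
    forall i, i < 12 -> a i = a 0 /\ a (12 + i) = a 12).
  { intros M rho a b. unfold H_link. rewrite sat_conj. split.
    - intros H i Hi.
      specialize (H _ (in_map _ _ i (proj2 (in_seq 12 0 i) ltac:(lia)))).
      cbn [sat] in H. rewrite !Ex in H by (unfold X1, X2; lia). exact H.
    - intros H f Hf. apply in_map_iff in Hf. destruct Hf as (i & <- & Hi).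
      apply in_seq in Hi. cbn [sat]. rewrite !Ex by (unfold X1, X2; lia).
      apply H. lia. }
  split.
  - cbn [wf]. split; [reflexivity|split; [reflexivity|split; [|split]]].
    + change (H_xs ++ H_ys) with (seq 0 48). apply seq_NoDup.
    + cbn. tauto.
    + cbn. tauto.
  - assert (H : forallb (fun v => Nat.ltb v 72) (fv (FAnd H_glue H_link)) = true)
      by reflexivity.
    rewrite forallb_forall in H. intros v Hv. apply Nat.ltb_lt. auto.
  - intros M rho phi. cbn [sat]. intros (F & Hdep & HF).
    (* A Skolem function reads a single universal, so its values on constant tuples determine a
       unary function. *)
    exists (fun i x => F i (fun _ => x)). intros x1 x2.
    set (a := fun i => if Nat.ltb i 12 then x1 else x2).
    assert (HF' : forall b, sat (Hq 24) M (env M rho b (fun j => F j b)) H_glue /\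
      sat (Hq 24) M (env M rho b (fun j => F j b)) (imp H_link phi))
      by (intros b; apply HF).
    assert (Hd : forall i, i < 24 -> F i a = F i (fun _ => a i)).
    { intros i Hi. apply Hdep. cbn [Hq hA hD]. intros i' _ E.
      apply Nat.eqb_eq in E. now subst. }
    exists (env M rho a (fun j => F j a)). split.
    + split; [|split; [|split; [|split]]].
      * apply Ex. unfold X1. lia.
      * apply Ex. unfold X2. lia.
      * intros i Hi. unfold Y1. rewrite Ey by lia. rewrite Hd by lia.
        unfold a. now rewrite (proj2 (Nat.ltb_lt i 12) Hi).
      * intros i Hi. unfold Y2. change (36 + i) with (24 + (12 + i)).
        rewrite Ey by lia. rewrite Hd by lia. unfold a at 1.
        rewrite (proj2 (Nat.ltb_ge (12 + i) 12)) by lia.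
        (* The constant tuple [x2] satisfies the premises of the glue, which equates the two copies
           at [x2]. *)
        symmetry. apply (proj1 (Eglue _ _ _ _) (proj1 (HF' (fun _ => x2)))); auto.
      * intros v Hv. apply Eo. lia.
    + pose proof (proj2 (HF' a)) as H. rewrite sat_imp in H. apply H.
      apply Elink. intros i Hi. unfold a.
      rewrite (proj2 (Nat.ltb_lt i 12) Hi).
      now rewrite (proj2 (Nat.ltb_ge (12 + i) 12)) by lia.
  - intros M rho f phi H. cbn [sat].
    (* Both copies are interpreted by [f]; indices from 24 on get the default element [rho 0]. *)
    exists (fun j a => if Nat.ltb j 12 then f j (a j) else
      if Nat.ltb j 24 then f (j - 12) (a j) else rho 0).
    split.
    + intros j a a' Ha. cbn [Hq hA hD] in Ha.
      destruct (Nat.ltb_spec j 12); [|destruct (Nat.ltb_spec j 24); [|easy]];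
        rewrite (Ha j); auto using Nat.eqb_refl; lia.
    + intros a. set (b := fun j => if Nat.ltb j 12 then f j (a j) else
        if Nat.ltb j 24 then f (j - 12) (a j) else rho 0).
      assert (b1 : forall i, i < 12 -> b i = f i (a i)).
      { intros i Hi. unfold b. now rewrite (proj2 (Nat.ltb_lt i 12) Hi). }
      assert (b2 : forall i, i < 12 -> b (12 + i) = f i (a (12 + i))).
      { intros i Hi. unfold b. rewrite (proj2 (Nat.ltb_ge (12 + i) 12)) by lia.
        rewrite (proj2 (Nat.ltb_lt (12 + i) 24)) by lia.
        now replace (12 + i - 12) with i by lia. }
      fold (env M rho a b).
      change (sat (Hq 24) M (env M rho a b) H_glue /\
              sat (Hq 24) M (env M rho a b) (imp H_link phi)).
      rewrite Eglue, sat_imp, Elink. split.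
      * intros i Hi E. rewrite b1, b2 by auto. now rewrite E.
      * intros Hl. apply (H (a 0) (a 12)).
        split; [|split; [|split; [|split]]].
        -- apply Ex. unfold X1. lia.
        -- apply Ex. unfold X2. lia.
        -- intros i Hi. unfold Y1. rewrite Ey, b1 by lia.
           now rewrite (proj1 (Hl i Hi)).
        -- intros i Hi. unfold Y2. change (36 + i) with (24 + (12 + i)).
           rewrite Ey, b2 by lia. now rewrite (proj2 (Hl i Hi)).
        -- intros v Hv. apply Eo. lia.
Qed.

(** Each row already shares one universal among its functions, so the link is trivial. The first
    twelve functions of each row take the variables [Y1 i] or [Y2 i]; the other twelve take 48 to 59
    or 60 to 71. *)
Definition E_xs := [0; 12].
Definition E_ys := (seq 24 12 ++ seq 48 12) ++ (seq 36 12 ++ seq 60 12).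
Definition E_glue : form :=
  conj (map (fun i => imp (FEq X1 X2) (FEq (Y1 i) (Y2 i))) (seq 0 12)).
Definition E_link : form := FEq X1 X1.

Lemma E_prefix : two_point_prefix (Eq_ 24) E_xs E_ys E_glue E_link.
Proof.
  set (env := fun (M : Type) (rho : nat -> M) a b =>
    upd_list (upd_list rho E_xs a) E_ys b).
  assert (N : NoDup (E_xs ++ E_ys)).
  { assert (H : nodup Nat.eq_dec (E_xs ++ E_ys) = E_xs ++ E_ys) by reflexivity.
    rewrite <- H. apply NoDup_nodup. }
  pose proof (NoDup_app_remove_l _ _ N) as Ny.
  assert (Ex1 : forall M (rho : nat -> M) a b, env M rho a b X1 = a 0)
    by reflexivity.
  assert (Ex2 : forall M (rho : nat -> M) a b, env M rho a b X2 = a 1)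
    by reflexivity.
  assert (Ey1 : forall M (rho : nat -> M) a b i, i < 12 ->
            env M rho a b (Y1 i) = b i).
  { intros M rho a b i Hi. apply upd_list_nth; [exact Ny|].
    do 12 (destruct i as [|i]; [reflexivity|]). lia. }
  assert (Ey2 : forall M (rho : nat -> M) a b i, i < 12 ->
            env M rho a b (Y2 i) = b (24 + i)).
  { intros M rho a b i Hi. apply upd_list_nth; [exact Ny|].
    do 12 (destruct i as [|i]; [reflexivity|]). lia. }
  assert (Eo : forall M (rho : nat -> M) a b v, 72 <= v -> env M rho a b v = rho v).
  { intros M rho a b v Hv. unfold env. rewrite !upd_list_notin; auto.
    - cbn [E_xs In]. lia.
    - unfold E_ys. rewrite !in_app_iff, !in_seq. lia. }
  assert (Eglue : forall M (rho : nat -> M) a b,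
    sat (Eq_ 24) M (env M rho a b) E_glue <->
    forall i, i < 12 -> a 0 = a 1 -> b i = b (24 + i)).
  { intros M rho a b. unfold E_glue. rewrite sat_conj. split.
    - intros H i Hi.
      specialize (H _ (in_map _ _ i (proj2 (in_seq 12 0 i) ltac:(lia)))).
      rewrite sat_imp in H. cbn [sat] in H.
      rewrite Ex1, Ex2, Ey1, Ey2 in H by lia. exact H.
    - intros H f Hf. apply in_map_iff in Hf. destruct Hf as (i & <- & Hi).
      apply in_seq in Hi. rewrite sat_imp. cbn [sat].
      rewrite Ex1, Ex2, Ey1, Ey2 by lia. apply H. lia. }
  split.
  - cbn [wf]. split; [reflexivity|split; [reflexivity|split; [exact N|]]].
    cbn. tauto.
  - assert (H : forallb (fun v => Nat.ltb v 72) (fv (FAnd E_glue E_link)) = true)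
      by reflexivity.
    rewrite forallb_forall in H. intros v Hv. apply Nat.ltb_lt. auto.
  - intros M rho phi. cbn [sat]. intros (F & Hdep & HF).
    exists (fun i x => F i (fun _ => x)). intros x1 x2.
    set (a := fun i : nat => match i with 0 => x1 | _ => x2 end).
    assert (HF' : forall b, sat (Eq_ 24) M (env M rho b (fun j => F j b)) E_glue /\
      sat (Eq_ 24) M (env M rho b (fun j => F j b)) (imp E_link phi))
      by (intros b; apply HF).
    exists (env M rho a (fun j => F j a)). split.
    + split; [|split; [|split; [|split]]].
      * apply Ex1.
      * apply Ex2.
      * intros i Hi. rewrite Ey1 by lia. apply Hdep. cbn [Eq_ hA hD].
        rewrite (proj2 (Nat.ltb_lt i 24)) by lia.
        intros i' _ E. apply Nat.eqb_eq in E. now subst.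
      * intros i Hi. rewrite Ey2 by lia. transitivity (F (24 + i) (fun _ => x2)).
        -- apply Hdep. cbn [Eq_ hA hD].
           rewrite (proj2 (Nat.ltb_ge (24 + i) 24)) by lia.
           intros i' _ E. apply Nat.eqb_eq in E. now subst.
        -- symmetry.
           apply (proj1 (Eglue _ _ _ _) (proj1 (HF' (fun _ => x2)))); auto.
      * intros v Hv. now apply Eo.
    + pose proof (proj2 (HF' a)) as H. rewrite sat_imp in H. now apply H.
  - intros M rho f phi H. cbn [sat].
    exists (fun j a => if Nat.ltb j 24 then f j (a 0) else f (j - 24) (a 1)).
    split.
    + intros j a a' Ha. cbn [Eq_ hA hD] in Ha.
      destruct (Nat.ltb_spec j 24); rewrite Ha; auto.
    + intros a. set (b := fun j => if Nat.ltb j 24 then f j (a 0)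
        else f (j - 24) (a 1)).
      assert (b1 : forall i, i < 12 -> b i = f i (a 0)).
      { intros i Hi. unfold b. now rewrite (proj2 (Nat.ltb_lt i 24)) by lia. }
      assert (b2 : forall i, i < 12 -> b (24 + i) = f i (a 1)).
      { intros i Hi. unfold b. rewrite (proj2 (Nat.ltb_ge (24 + i) 24)) by lia.
        now replace (24 + i - 24) with i by lia. }
      change (sat (Eq_ 24) M (env M rho a b) E_glue /\
              sat (Eq_ 24) M (env M rho a b) (imp E_link phi)).
      rewrite Eglue, sat_imp. split.
      * intros i Hi E. rewrite b1, b2 by auto. now rewrite E.
      * intros _. apply (H (a 0) (a 1)).
        split; [|split; [|split; [|split]]].
        -- apply Ex1.
        -- apply Ex2.
        -- intros i Hi. now rewrite Ey1, b1.
        -- intros i Hi. now rewrite Ey2, b2.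
        -- intros v Hv. now apply Eo.
Qed.

(** * Describing a run of a machine *)

(* [M] contains numbers, with successor [fS], and one cell per register and
   instant.  [fN] is the same register at the next instant; [fT], [fR], [fV],
   [fQ] are the instant, register, content and program counter of a cell.  The
   other functions are composites, needed because a clause sees two points only. *)
Definition fS := 0.   (* successor *)
Definition fP := 1.   (* predecessor *)
Definition fZ := 2.   (* sign *)
Definition fN := 3.
Definition fT := 4.
Definition fM := 5.   (* fS o fT *)
Definition fV := 6.
Definition fW := 7.   (* fS o fV *)
Definition fU := 8.   (* fP o fV *)
Definition fO := 9.   (* fZ o fV *)
Definition fR := 10.
Definition fQ := 11.

(** A premise that makes the second point an image of the first lets a clause express an equation
    between composites. The last clause makes the program counter depend on the instant alone. *)
Definition structure_clauses : list form :=
  [clause [(X2, Y1 fS)] (FEq (Y2 fP) X1);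
   clause [(X2, Y1 fS)] (FEq (Y2 fZ) (D 1));
   clause [(X1, D 0)] (FEq (Y1 fZ) (D 0));
   clause [(X2, Y1 fT)] (FEq (Y1 fM) (Y2 fS));
   clause [(X2, Y1 fN)] (FEq (Y2 fT) (Y1 fM));
   clause [(X2, Y1 fV)] (FEq (Y1 fW) (Y2 fS));
   clause [(X2, Y1 fV)] (FEq (Y1 fU) (Y2 fP));
   clause [(X2, Y1 fV)] (FEq (Y1 fO) (Y2 fZ));
   clause [(X2, Y1 fN)] (FEq (Y2 fR) (Y1 fR));
   clause [(Y1 fT, Y2 fT)] (FEq (Y1 fQ) (Y2 fQ))].

(** The constant [D j] plays three roles: the number [j], the name of register [j], and the cell of
    that register at instant 0. *)
Definition initial_clauses (j : nat) : list form :=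
  [clause [(X1, D j)] (FEq (Y1 fT) (D 0));
   clause [(X1, D j)] (FEq (Y1 fR) (D j));
   clause [(X1, D j)] (FEq (Y1 fV) (if Nat.eqb j 0 then L else D 0));
   clause [(X1, D j)] (FEq (Y1 fQ) (D 0))].

(** Leaving the program is falsity, so halting becomes a contradiction. *)
Definition goto (len t : nat) : form :=
  if Nat.ltb t len then FEq (Y2 fQ) (D t) else FNeg (FEq X1 X1).

Definition reg_of (ins : instr) : nat :=
  match ins with INC r => r | DEC r _ => r end.

(** Only the cell of the register acted upon fixes the next program counter; the other cells of that
    instant inherit it. The sign [fO] of the content selects the branch of a [DEC]. *)
Definition cell_clauses (len i : nat) (ins : instr) (j : nat) : list form :=
  let here := [(X2, Y1 fN); (Y1 fQ, D i); (Y1 fR, D j)] in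
  if Nat.eqb j (reg_of ins) then
    match ins with
    | INC _ =>
        [clause here (FEq (Y2 fV) (Y1 fW)); clause here (goto len (S i))]
    | DEC _ t =>
        [clause ((Y1 fO, D 0) :: here) (FEq (Y2 fV) (Y1 fV));
         clause ((Y1 fO, D 0) :: here) (goto len t);
         clause ((Y1 fO, D 1) :: here) (FEq (Y2 fV) (Y1 fU));
         clause ((Y1 fO, D 1) :: here) (goto len (S i))]
    end
  else [clause here (FEq (Y2 fV) (Y1 fV))].

Definition instr_clauses (p : program) (k i : nat) : list form :=
  match nth_error p i with
  | Some ins => flat_map (cell_clauses (length p) i ins) (seq 0 k)
  | None => []
  end.

Definition machine_clauses (p : program) (k : nat) : list form :=
  structure_clauses ++ flat_map initial_clauses (seq 0 k) ++
  flat_map (instr_clauses p k) (seq 0 (length p)).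

(** * Semantics of the clauses *)

Fixpoint horn {M : Type} (r : nat -> M) (prem : list (nat * nat)) (P : Prop)
    : Prop :=
  match prem with
  | [] => P
  | e :: prem' => r (fst e) = r (snd e) -> horn r prem' P
  end.

Lemma sat_clause Q M (r : nat -> M) prem concl :
  sat Q M r (clause prem concl) <-> horn r prem (sat Q M r concl).
Proof.
  induction prem as [|e prem IH]; [easy|].
  cbn [clause fold_right horn]. rewrite sat_imp. cbn [sat].
  fold (clause prem concl). now rewrite IH.
Qed.

Lemma wf_clause Q prem concl : wf Q concl -> wf Q (clause prem concl).
Proof.
  intros H. induction prem as [|e prem IH]; [easy|].
  cbn [clause fold_right imp wf]. auto.
Qed.

Lemma wf_conj Q l : (forall f, In f l -> wf Q f) -> wf Q (conj l).
Proof.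
  induction l as [|f l IH]; cbn [conj wf In]; intros H; auto.
Qed.

Lemma wf_machine Q p k : wf Q (conj (machine_clauses p k)).
Proof.
  assert (G : forall t, wf Q (goto (length p) t))
    by (intros t; unfold goto; now destruct (Nat.ltb t (length p))).
  apply wf_conj. intros f Hf. unfold machine_clauses in Hf.
  rewrite !in_app_iff, !in_flat_map in Hf.
  destruct Hf as [Hf|[(j & _ & Hf)|(i & _ & Hf)]].
  - unfold structure_clauses in Hf. cbn [In] in Hf.
    repeat (destruct Hf as [<-|Hf]; [now apply wf_clause|]). easy.
  - unfold initial_clauses in Hf. cbn [In] in Hf.
    repeat (destruct Hf as [<-|Hf]; [now apply wf_clause|]). easy.
  - unfold instr_clauses in Hf. destruct (nth_error p i) as [ins|]; [|easy].
    apply in_flat_map in Hf. destruct Hf as (j & _ & Hf).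
    unfold cell_clauses in Hf.
    destruct (Nat.eqb j (reg_of ins)); [destruct ins|]; cbn [In] in Hf;
      repeat (destruct Hf as [<-|Hf]; [apply wf_clause; auto; easy|]); easy.
Qed.

Definition at_pc {M : Type} (len : nat) (d : nat -> M) (f : nat -> M -> M)
    (t : nat) (y : M) : Prop :=
  if Nat.ltb t len then f fQ y = d t else False.

(** The machine clauses read in [M], free of variables: [l] is the value of [L] and [d i] that of
    [D i]. *)
Record simulation {M : Type} (p : program) (k : nat) (l : M) (d : nat -> M)
    (f : nat -> M -> M) : Prop := {
  sim_pred : forall x, f fP (f fS x) = x;
  sim_sign_S : forall x, f fZ (f fS x) = d 1;
  sim_sign_0 : f fZ (d 0) = d 0;
  sim_M : forall x, f fM x = f fS (f fT x);
  sim_NT : forall x, f fT (f fN x) = f fM x;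
  sim_W : forall x, f fW x = f fS (f fV x);
  sim_U : forall x, f fU x = f fP (f fV x);
  sim_O : forall x, f fO x = f fZ (f fV x);
  sim_NR : forall x, f fR (f fN x) = f fR x;
  sim_Q : forall x y, f fT x = f fT y -> f fQ x = f fQ y;
  sim_initial : forall j, j < k ->
    f fT (d j) = d 0 /\ f fR (d j) = d j /\
    f fV (d j) = (if Nat.eqb j 0 then l else d 0) /\ f fQ (d j) = d 0;
  sim_step : forall i ins j x, nth_error p i = Some ins -> j < k ->
    f fQ x = d i -> f fR x = d j ->
    if Nat.eqb j (reg_of ins) then
      match ins with
      | INC _ => f fV (f fN x) = f fW x /\ at_pc (length p) d f (S i) (f fN x)
      | DEC _ t =>
          (f fO x = d 0 ->
             f fV (f fN x) = f fV x /\ at_pc (length p) d f t (f fN x)) /\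
          (f fO x = d 1 ->
             f fV (f fN x) = f fU x /\ at_pc (length p) d f (S i) (f fN x))
      end
    else f fV (f fN x) = f fV x
}.

Lemma sat_goto Q M (f : nat -> M -> M) x1 x2 rho r len t :
  good_env f x1 x2 rho r ->
  sat Q M r (goto len t) <-> at_pc len (fun i => rho (D i)) f t x2.
Proof.
  intros (_ & _ & _ & E4 & E5). unfold goto, at_pc.
  destruct (Nat.ltb t len); cbn [sat]; [|tauto].
  rewrite E4 by (apply Nat.ltb_lt; reflexivity). rewrite E5; [easy|].
  unfold D. lia.
Qed.

Ltac read_env G :=
  let E1 := fresh in let E2 := fresh in let E3 := fresh in
  let E4 := fresh in let E5 := fresh in
  pose proof G as (E1 & E2 & E3 & E4 & E5);
  cbn [horn fst snd] in *;
  repeat match goal with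
  | H : context [sat _ _ _ (goto _ _)] |- _ => rewrite (sat_goto _ _ _ _ _ _ _ _ _ G) in H
  | |- context [sat _ _ _ (goto _ _)] => rewrite (sat_goto _ _ _ _ _ _ _ _ _ G)
  end;
  cbn [sat] in *;
  rewrite ?E1, ?E2 in *;
  rewrite ?E3, ?E4 in * by (apply Nat.ltb_lt; reflexivity);
  rewrite ?E5 in * by (unfold D, L; lia);
  clear E1 E2 E3 E4 E5.

Ltac use_clause B x1 x2 prem concl :=
  let r := fresh "r" in let G := fresh "G" in let H := fresh "H" in
  destruct (B x1 x2 prem concl) as (r & G & H);
  [cbn [In structure_clauses initial_clauses]; tauto|];
  read_env G; auto.

(** An equation between composites is its clause evaluated at [x] and at the image of [x] that the
    premise names, where that premise is true. *)
Lemma sat_machine_simulation Q M (f : nat -> M -> M) rho p k :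
  (forall x1 x2, exists r,
     good_env f x1 x2 rho r /\ sat Q M r (conj (machine_clauses p k))) ->
  simulation p k (rho L) (fun i => rho (D i)) f.
Proof.
  intros H.
  assert (C : forall x1 x2 prem concl,
    In (clause prem concl) (machine_clauses p k) ->
    exists r, good_env f x1 x2 rho r /\ horn r prem (sat Q M r concl)).
  { intros x1 x2 prem concl Hin. destruct (H x1 x2) as (r & G & S).
    exists r. split; [exact G|]. rewrite sat_conj in S.
    apply sat_clause. now apply S. }
  clear H.
  assert (B : forall x1 x2 prem concl,
    In (clause prem concl) structure_clauses ->
    exists r, good_env f x1 x2 rho r /\ horn r prem (sat Q M r concl)).
  { intros x1 x2 prem concl Hin. apply C. apply in_app_iff. now left. }
  assert (I : forall j x1 x2 prem concl, j < k ->
    In (clause prem concl) (initial_clauses j) ->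
    exists r, good_env f x1 x2 rho r /\ horn r prem (sat Q M r concl)).
  { intros j x1 x2 prem concl Hj Hin. apply C. unfold machine_clauses.
    rewrite !in_app_iff. right. left. apply in_flat_map. exists j.
    split; [apply in_seq; lia|easy]. }
  assert (T : forall i ins j x1 x2 prem concl, nth_error p i = Some ins -> j < k ->
    In (clause prem concl) (cell_clauses (length p) i ins j) ->
    exists r, good_env f x1 x2 rho r /\ horn r prem (sat Q M r concl)).
  { intros i ins j x1 x2 prem concl Hi Hj Hin. apply C. unfold machine_clauses.
    rewrite !in_app_iff. right. right. apply in_flat_map. exists i.
    split; [apply in_seq; split; [lia|];
      apply nth_error_Some; rewrite Hi; discriminate|].
    unfold instr_clauses. rewrite Hi. apply in_flat_map. exists j.
    split; [apply in_seq; lia|easy]. }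
  clear C.
  split.
  - intros x. use_clause B x (f fS x) [(X2, Y1 fS)] (FEq (Y2 fP) X1).
  - intros x. use_clause B x (f fS x) [(X2, Y1 fS)] (FEq (Y2 fZ) (D 1)).
  - use_clause B (rho (D 0)) (rho (D 0)) [(X1, D 0)] (FEq (Y1 fZ) (D 0)).
  - intros x. use_clause B x (f fT x) [(X2, Y1 fT)] (FEq (Y1 fM) (Y2 fS)).
  - intros x. use_clause B x (f fN x) [(X2, Y1 fN)] (FEq (Y2 fT) (Y1 fM)).
  - intros x. use_clause B x (f fV x) [(X2, Y1 fV)] (FEq (Y1 fW) (Y2 fS)).
  - intros x. use_clause B x (f fV x) [(X2, Y1 fV)] (FEq (Y1 fU) (Y2 fP)).
  - intros x. use_clause B x (f fV x) [(X2, Y1 fV)] (FEq (Y1 fO) (Y2 fZ)).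
  - intros x. use_clause B x (f fN x) [(X2, Y1 fN)] (FEq (Y2 fR) (Y1 fR)).
  - intros x y. use_clause B x y [(Y1 fT, Y2 fT)] (FEq (Y1 fQ) (Y2 fQ)).
  - intros j Hj. specialize (I j). set (x := rho (D j)).
    split; [|split; [|split]].
    + destruct (I x x [(X1, D j)] (FEq (Y1 fT) (D 0)) Hj) as (r & G & H);
        [cbn; tauto|read_env G; auto].
    + destruct (I x x [(X1, D j)] (FEq (Y1 fR) (D j)) Hj) as (r & G & H);
        [cbn; tauto|read_env G; auto].
    + destruct (I x x [(X1, D j)] (FEq (Y1 fV) (if Nat.eqb j 0 then L else D 0)) Hj)
        as (r & G & H); [cbn; tauto|].
      destruct (Nat.eqb j 0); read_env G; auto.
    + destruct (I x x [(X1, D j)] (FEq (Y1 fQ) (D 0)) Hj) as (r & G & H);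
        [cbn; tauto|read_env G; auto].
  - intros i ins j x Hi Hj HQ HR. specialize (T i ins j x (f fN x)).
    unfold cell_clauses in T.
    set (here := [(X2, Y1 fN); (Y1 fQ, D i); (Y1 fR, D j)]) in T.
    destruct (Nat.eqb j (reg_of ins)); [destruct ins as [r0|r0 t]|].
    + split.
      * destruct (T here (FEq (Y2 fV) (Y1 fW)) Hi Hj) as (r & G & H);
          [cbn [In]; tauto|subst here; read_env G; auto].
      * destruct (T here (goto (length p) (S i)) Hi Hj) as (r & G & H);
          [cbn [In]; tauto|subst here; read_env G; auto].
    + split; intros HO; split.
      * destruct (T ((Y1 fO, D 0) :: here) (FEq (Y2 fV) (Y1 fV)) Hi Hj) as (r & G & H);
          [cbn [In]; tauto|subst here; read_env G; auto].
      * destruct (T ((Y1 fO, D 0) :: here) (goto (length p) t) Hi Hj) as (r & G & H);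
          [cbn [In]; tauto|subst here; read_env G; auto].
      * destruct (T ((Y1 fO, D 1) :: here) (FEq (Y2 fV) (Y1 fU)) Hi Hj) as (r & G & H);
          [cbn [In]; tauto|subst here; read_env G; auto].
      * destruct (T ((Y1 fO, D 1) :: here) (goto (length p) (S i)) Hi Hj) as (r & G & H);
          [cbn [In]; tauto|subst here; read_env G; auto].
    + destruct (T here (FEq (Y2 fV) (Y1 fV)) Hi Hj) as (r & G & H);
        [cbn [In]; tauto|subst here; read_env G; auto].
Qed.

Lemma simulation_sat_machine Q M (f : nat -> M -> M) rho p k x1 x2 r :
  simulation p k (rho L) (fun i => rho (D i)) f -> good_env f x1 x2 rho r ->
  sat Q M r (conj (machine_clauses p k)).
Proof.
  intros S G. apply sat_conj. intros c Hc. unfold machine_clauses in Hc.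
  rewrite !in_app_iff, !in_flat_map in Hc.
  destruct Hc as [Hc|[(j & Hj & Hc)|(i & _ & Hc)]].
  - cbn [structure_clauses In] in Hc.
    repeat (destruct Hc as [<-|Hc]; [apply sat_clause; read_env G|]);
      try easy; intros E; rewrite ?E.
    + apply (sim_pred _ _ _ _ _ S).
    + apply (sim_sign_S _ _ _ _ _ S).
    + apply (sim_sign_0 _ _ _ _ _ S).
    + apply (sim_M _ _ _ _ _ S).
    + apply (sim_NT _ _ _ _ _ S).
    + apply (sim_W _ _ _ _ _ S).
    + apply (sim_U _ _ _ _ _ S).
    + apply (sim_O _ _ _ _ _ S).
    + apply (sim_NR _ _ _ _ _ S).
    + now apply (sim_Q _ _ _ _ _ S).
  - apply in_seq in Hj. cbn [initial_clauses In] in Hc.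
    destruct (sim_initial _ _ _ _ _ S j ltac:(lia)) as (I1 & I2 & I3 & I4).
    repeat (destruct Hc as [<-|Hc]; [apply sat_clause|]); try easy.
    + read_env G. now intros ->.
    + read_env G. now intros ->.
    + destruct (Nat.eqb j 0); read_env G; now intros ->.
    + read_env G. now intros ->.
  - unfold instr_clauses in Hc.
    destruct (nth_error p i) as [ins|] eqn:Hi; [|easy].
    apply in_flat_map in Hc. destruct Hc as (j & Hj & Hc). apply in_seq in Hj.
    pose proof (fun x => sim_step _ _ _ _ _ S i ins j x Hi ltac:(lia)) as T.
    unfold cell_clauses in Hc.
    destruct (Nat.eqb j (reg_of ins)); [destruct ins as [r0|r0 t]|];
      cbn [In] in Hc;
      repeat (destruct Hc as [<-|Hc]; [apply sat_clause; read_env G|]); try easy;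
      intros; subst; apply T; auto.
Qed.

Lemma sat_numeral Q M (r : nat -> M) a n :
  sat Q M r (numeral a n) <->
  r L = r (D a) /\
  forall i, i < n -> r X1 = r (D i) -> r (Y1 fS) = r (D (S i)).
Proof.
  induction n as [|n IH]; cbn [numeral].
  - cbn [sat]. split; [|easy]. split; [easy|lia].
  - cbn [sat]. fold (sat Q M r (imp (FEq X1 (D n)) (FEq (Y1 0) (D (S n))))).
    rewrite IH, sat_imp. cbn [sat]. split.
    + intros (H1 & H2 & H3). split; [easy|]. intros i Hi.
      destruct (Nat.eq_dec i n) as [->|]; [easy|]. apply H3. lia.
    + intros (H1 & H2). split; [|split; [easy|]]; auto with arith.
Qed.

(** * Halting *)

Definition input (x : nat) : nat -> nat := fun v => if Nat.eqb v 0 then x else 0.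

(** Induction on the instant: the cell of register [j] at instant [t] is the [t]-th iterate of [fN]
    on [d j], and numbers are iterates of [fS] on [d 0]. Only equations are propagated, so the
    argument survives any identification of constants in [M]. *)
Lemma simulation_run M (f : nat -> M -> M) d p k a t pc regs :
  simulation p k (d a) d f -> (forall i, i < a -> f fS (d i) = d (S i)) ->
  0 < length p -> Forall (fun ins => reg_of ins < k) p ->
  reach p (0, input a) t (pc, regs) ->
  pc < length p /\ forall j, j < k ->
    let c := Nat.iter t (f fN) (d j) in
    f fT c = Nat.iter t (f fS) (d 0) /\ f fR c = d j /\
    f fV c = Nat.iter (regs j) (f fS) (d 0) /\ f fQ c = d pc.
Proof.
  intros Sim chain Hp Hk. remember (pc, regs) as c eqn:Ec. intros R.
  revert pc regs Ec.
  induction R as [|t pc0 regs0 c R IH E]; intros pc regs Ec.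
  - injection Ec as <- <-. split; [easy|]. intros j Hj.
    (* The chain of numerals turns the initial content [d a] into the [a]-th successor of [d 0]. *)
    assert (N : forall i, i <= a -> d i = Nat.iter i (f fS) (d 0)).
    { induction i as [|i IH]; intros Hi; [easy|]. rewrite Nat.iter_succ.
      rewrite <- IH by lia. symmetry. apply chain. lia. }
    destruct (sim_initial _ _ _ _ _ Sim j Hj) as (I1 & I2 & I3 & I4).
    cbn. repeat split; auto. rewrite I3. unfold input.
    destruct (Nat.eqb j 0); [now apply N|easy].
  - subst c. destruct (IH _ _ eq_refl) as [Hpc Hc]. clear IH R.
    unfold step in E. destruct (nth_error p pc0) as [ins|] eqn:Hi; [|easy].
    assert (Hr : reg_of ins < k)
      by (rewrite Forall_forall in Hk; apply Hk; eapply nth_error_In, Hi).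
    set (cell := fun j => Nat.iter t (f fN) (d j)).
    assert (HT : forall j, j < k ->
      f fT (f fN (cell j)) = Nat.iter (S t) (f fS) (d 0)).
    { intros j Hj. destruct (Hc j Hj) as (T & _).
      rewrite (sim_NT _ _ _ _ _ Sim), (sim_M _ _ _ _ _ Sim).
      fold (cell j) in T. now rewrite T, Nat.iter_succ. }
    assert (HR : forall j, j < k -> f fR (f fN (cell j)) = d j).
    { intros j Hj. destruct (Hc j Hj) as (_ & HR & _).
      now rewrite (sim_NR _ _ _ _ _ Sim). }
    assert (HO : forall j, j < k ->
      f fO (cell j) = if Nat.eqb (regs0 j) 0 then d 0 else d 1).
    { intros j Hj. destruct (Hc j Hj) as (_ & _ & V & _). fold (cell j) in V.
      rewrite (sim_O _ _ _ _ _ Sim), V. destruct (regs0 j); rewrite ?Nat.iter_succ; cbn [Nat.eqb].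
      - apply (sim_sign_0 _ _ _ _ _ Sim).
      - apply (sim_sign_S _ _ _ _ _ Sim). }
    pose proof (fun j Hj => sim_step _ _ _ _ _ Sim pc0 ins j (cell j) Hi Hj
      (proj2 (proj2 (proj2 (Hc j Hj)))) (proj1 (proj2 (Hc j Hj)))) as St.
    assert (HV : forall j, j < k -> j <> reg_of ins ->
      f fV (f fN (cell j)) = Nat.iter (regs0 j) (f fS) (d 0)).
    { intros j Hj Hne. specialize (St j Hj).
      rewrite (proj2 (Nat.eqb_neq _ _) Hne) in St. rewrite St. now apply Hc. }
    specialize (St _ Hr). rewrite Nat.eqb_refl in St.
    specialize (HO _ Hr).
    destruct (Hc _ Hr) as (_ & _ & V & _). fold (cell (reg_of ins)) in V.
    (* The register acted upon gives its new content and the new program counter; all other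
       registers keep their values. *)
    assert (G : f fV (f fN (cell (reg_of ins)))
                = Nat.iter (regs (reg_of ins)) (f fS) (d 0) /\
              at_pc (length p) d f pc (f fN (cell (reg_of ins))) /\
              forall j, j <> reg_of ins -> regs j = regs0 j).
    { destruct ins as [r|r l]; cbn [reg_of] in *.
      - injection E as <- <-. destruct St as [St1 St2].
        rewrite St1, (sim_W _ _ _ _ _ Sim), V, Nat.eqb_refl.
        split; [easy|split; [easy|]]. intros j Hj.
        now rewrite (proj2 (Nat.eqb_neq _ _) Hj).
      - destruct (regs0 r) as [|n] eqn:Er; injection E as <- <-;
          cbn [Nat.eqb] in HO; [apply proj1 in St|apply proj2 in St];
          destruct (St HO) as [St1 St2]; rewrite St1.
        + rewrite V, Er. split; [easy|split; easy].
        + rewrite (sim_U _ _ _ _ _ Sim), V, Nat.eqb_refl, Nat.iter_succ.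
          rewrite (sim_pred _ _ _ _ _ Sim). split; [easy|split; [easy|]].
          intros j Hj. now rewrite (proj2 (Nat.eqb_neq _ _) Hj). }
    destruct G as (G1 & G2 & G3). unfold at_pc in G2.
    (* A target outside the program would make [at_pc] false. *)
    destruct (Nat.ltb_spec pc (length p)) as [Hlt|]; [|easy].
    split; [easy|]. intros j Hj. rewrite Nat.iter_succ. fold (cell j).
    split; [now apply HT|split; [now apply HR|split]].
    + destruct (Nat.eq_dec j (reg_of ins)) as [->|Hne]; [easy|].
      rewrite G3 by easy. now apply HV.
    (* Cells of the same instant share their program counter. *)
    + rewrite <- G2. apply (sim_Q _ _ _ _ _ Sim). now rewrite !HT.
Qed.

Lemma halting_query_unsat Q xs ys glue link p k a M (rho : nat -> M) :
  two_point_prefix Q xs ys glue link ->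
  0 < length p -> 0 < k -> Forall (fun ins => reg_of ins < k) p ->
  halting p (0, input a) ->
  ~ sat Q M rho (query xs ys glue link (conj (machine_clauses p k)) a).
Proof.
  intros P Hp Hk Hr (pc & regs & [t R] & HN) HS.
  apply sat_FExs_elim in HS. destruct HS as [rho' HS].
  apply (prefix_elim _ _ _ _ _ P) in HS. destruct HS as [f Hf].
  assert (Sim : simulation p k (rho' L) (fun i => rho' (D i)) f).
  { apply sat_machine_simulation with (Q := Q). intros x1 x2.
    destruct (Hf x1 x2) as (r & G & HC & _). eauto. }
  assert (Num : rho' L = rho' (D a) /\
                forall i, i < a -> f fS (rho' (D i)) = rho' (D (S i))).
  { split.
    - destruct (Hf (rho' L) (rho' L)) as (r & G & _ & HN').
      apply sat_numeral in HN'. destruct HN' as [HN' _]. read_env G. exact HN'.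
    - intros i Hi. destruct (Hf (rho' (D i)) (rho' L)) as (r & G & _ & HN').
      apply sat_numeral in HN'. destruct HN' as [_ HN']. specialize (HN' i Hi).
      read_env G. now apply HN'. }
  destruct Num as [HL chain]. rewrite HL in Sim.
  pose proof (simulation_run M f (fun i => rho' (D i)) p k a t pc regs Sim chain
    Hp Hr R) as [Hpc _].
  apply step_None in HN. lia.
Qed.

(** * The model given by an infinite run *)

Definition next (p : program) (c : config) : config :=
  match step p (fst c) (snd c) with Some c' => c' | None => c end.

Lemma nonhalting_run p c :
  ~ halting p c ->
  exists run : nat -> config, run 0 = c /\
    forall t, step p (fst (run t)) (snd (run t)) = Some (run (S t)).
Proof.
  intros H. exists (fun t => Nat.iter t (next p) c). split; [easy|].
  assert (Hr : forall t, star p c (Nat.iter t (next p) c) /\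
    step p (fst (Nat.iter t (next p) c)) (snd (Nat.iter t (next p) c))
    = Some (Nat.iter (S t) (next p) c)).
  { assert (Hs : forall c', star p c c' ->
      step p (fst c') (snd c') = Some (next p c')).
    { intros [pc regs] Hc. unfold next. cbn [fst snd].
      destruct (step p pc regs) eqn:E; [easy|]. destruct H. now exists pc, regs. }
    induction t as [|t [IH1 IH2]].
    - split; [apply star_refl|]. apply Hs, star_refl.
    - assert (Hn : star p c (Nat.iter (S t) (next p) c)).
      { eapply star_trans; [exact IH1|].
        destruct (Nat.iter t (next p) c) as [pc regs]. now apply star_step. }
      split; [exact Hn|]. now apply Hs. }
  intros t. apply Hr.
Qed.

(** The pair [(t, j)] is the cell of register [j] at instant [t], and [(0, i)] is also the number
    [i]; so initial cells coincide with the constants, as [initial_clauses] requires. *)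
Definition intended (run : nat -> config) (i : nat) (x : nat * nat) : nat * nat :=
  let (t, j) := x in
  let v := snd (run t) j in
  match i with
  | 0 => (t, S j)
  | 1 => (t, Nat.pred j)
  | 2 => (0, if Nat.eqb j 0 then 0 else 1)
  | 3 => (S t, j)
  | 4 => (0, t)
  | 5 => (0, S t)
  | 6 => (0, v)
  | 7 => (0, S v)
  | 8 => (0, Nat.pred v)
  | 9 => (0, if Nat.eqb v 0 then 0 else 1)
  | 10 => (0, j)
  | _ => (0, fst (run t))
  end.

Lemma intended_simulation p k a run :
  run 0 = (0, input a) ->
  (forall t, step p (fst (run t)) (snd (run t)) = Some (run (S t))) ->
  simulation p k (0, a) (fun i => (0, i)) (intended run).
Proof.
  intros H0 HS. split; try (intros [t j]; reflexivity).
  - reflexivity.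
  - intros [t j] [t' j'] [= ->]. reflexivity.
  - intros j _. cbn. rewrite H0. unfold input. cbn.
    repeat split. now destruct j.
  - intros i ins j [t j'] Hi _ HQ HR. injection HQ as HQ. injection HR as <-.
    (* The machine steps again from the next configuration, so its program counter is in range and
       [goto] is never falsity here. *)
    assert (Hlt : fst (run (S t)) < length p).
    { apply Nat.nle_gt. intros Hle. apply (step_None _ _ (snd (run (S t)))) in Hle.
      rewrite HS in Hle. discriminate. }
    specialize (HS t). unfold step in HS. rewrite HQ, Hi in HS.
    assert (A : forall q, fst (run (S t)) = q ->
      at_pc (length p) (fun i => (0, i)) (intended run) q (intended run fN (t, j'))).
    { intros q <-. unfold at_pc. now rewrite (proj2 (Nat.ltb_lt _ _) Hlt). }
    destruct ins as [r|r l]; cbn [reg_of];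
      [|destruct (snd (run t) r) as [|n] eqn:Er];
      injection HS as HS; destruct (Nat.eqb_spec j' r) as [->|Hne];
      try (cbn; rewrite <- HS; cbn; rewrite ?Nat.eqb_refl, ?(proj2 (Nat.eqb_neq _ _) Hne); reflexivity).
    + split; [|apply A; now rewrite <- HS].
      cbn. rewrite <- HS. cbn. now rewrite Nat.eqb_refl.
    + split; intros HO; [|cbn in HO; rewrite Er in HO; discriminate].
      split; [|apply A; now rewrite <- HS].
      cbn. now rewrite <- HS.
    + split; intros HO; [cbn in HO; rewrite Er in HO; discriminate|].
      split; [|apply A; now rewrite <- HS].
      cbn. rewrite <- HS, Er. cbn. now rewrite Nat.eqb_refl.
Qed.

Lemma nonhalting_query_sat Q xs ys glue link p k a :
  two_point_prefix Q xs ys glue link -> ~ halting p (0, input a) ->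
  exists rho, sat Q (nat * nat) rho
    (query xs ys glue link (conj (machine_clauses p k)) a).
Proof.
  intros P H. apply nonhalting_run in H. destruct H as (run & H0 & HS).
  (* Truncated subtraction gives the variables below [L] the value [(0, 0)]. Taking [e] as outer
     assignment too makes the quantifier block yield [e] everywhere. *)
  set (e := fun v : nat => if Nat.eqb v L then (0, a) else (0, v - 73)).
  assert (ED : forall i, e (D i) = (0, i)).
  { intros i. unfold e, D, L. destruct (Nat.eqb_spec (73 + i) 72); [lia|].
    f_equal. lia. }
  exists e. apply sat_FExs_intro with (e := e). intros rho H1 H2.
  assert (E : rho = e).
  { apply functional_extensionality. intros v.
    destruct (Nat.lt_ge_cases v (a + 74)); auto. }
  subst rho. clear H1 H2.
  apply (prefix_intro _ _ _ _ _ P) with (f := intended run).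
  intros x1 x2 r G. cbn [sat]. split.
  - apply (simulation_sat_machine Q _ (intended run) e p k x1 x2 r); [|exact G].
    replace (fun i => e (D i)) with (fun i : nat => (0, i))
      by (apply functional_extensionality; intros i; now rewrite ED).
    now apply intended_simulation.
  - apply sat_numeral. read_env G. rewrite ED. split; [easy|]. intros i _.
    read_env G. rewrite !ED. now intros ->.
Qed.

(** * Diagonalization *)

Lemma halting_step p pc regs c :
  step p pc regs = Some c -> halting p (pc, regs) -> halting p c.
Proof.
  intros E (pc' & regs' & [t R] & HN).
  assert (G : forall t h, reach p (pc, regs) t h -> h = (pc, regs) \/ star p c h).
  { clear t R. induction 1 as [|t pc1 regs1 c1 _ [[= -> ->]|IH] E1]; auto.
    - right. rewrite E in E1. injection E1 as <-. apply star_refl.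
    - right. eapply star_trans; [exact IH|]. now apply star_step. }
  apply G in R. destruct R as [[= -> ->]|R].
  - rewrite E in HN. discriminate.
  - now exists pc', regs'.
Qed.

Lemma halting_star p c c' : star p c c' -> halting p c -> halting p c'.
Proof.
  intros [t R] H. induction R as [|t pc regs c' _ IH E]; auto.
  eapply halting_step; eauto.
Qed.

Lemma self_loop_not_halting p pc regs :
  step p pc regs = Some (pc, regs) -> ~ halting p (pc, regs).
Proof.
  intros E (pc' & regs' & [t R] & HN).
  assert (G : forall t h, reach p (pc, regs) t h -> h = (pc, regs)).
  { clear t R. induction 1 as [|t pc1 regs1 c1 _ [= -> ->] E1]; auto.
    rewrite E in E1. now injection E1. }
  apply G in R. injection R as -> ->. rewrite E in HN. discriminate.
Qed.

(** Truncating targets at [n] collects all exits of the program at the single address [off + n]. *)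
Definition relocate (off n : nat) (ins : instr) : instr :=
  match ins with INC r => INC r | DEC r j => DEC r (off + Nat.min j n) end.

Lemma relocate_star p off q c c' :
  occurs_at p off (map (relocate off (length q)) q) -> star q c c' ->
  star p (off + Nat.min (fst c) (length q), snd c)
         (off + Nat.min (fst c') (length q), snd c').
Proof.
  intros H [t R]. induction R as [|t pc regs c' _ IH E]; [apply star_refl|].
  eapply star_trans; [exact IH|]. apply star_step. cbn [fst snd].
  unfold step in E. destruct (nth_error q pc) as [ins|] eqn:Hi; [|easy].
  assert (Hlt : pc < length q) by (apply nth_error_Some; rewrite Hi; discriminate).
  unfold step. rewrite Nat.min_l by lia.
  rewrite (occurs_at_nth _ _ _ pc H) by now rewrite length_map.
  rewrite nth_error_map, Hi. cbn [option_map].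
  destruct ins as [r|r j]; cbn [relocate].
  - injection E as <-. cbn [fst snd]. rewrite Nat.min_l by lia.
    now rewrite Nat.add_succ_r.
  - destruct (regs r); injection E as <-; cbn [fst snd]; [easy|].
    rewrite (Nat.min_l (S pc)) by lia. now rewrite Nat.add_succ_r.
Qed.

(* Entered with register 0 holding 0 the last two instructions halt; entered
   with 1, they loop on the last one. *)
Definition diagonal (enc q : program) : program :=
  let off := length enc in
  let n := length q in
  enc ++ map (relocate off n) q ++ [DEC 0 (off + n + 2); DEC 0 (off + n + 1)].

Lemma regs_of_input x : regs_of [x; 0; 0; 0; 0; 0; 0; 0; 0; 0] = input x.
Proof.
  apply functional_extensionality. intros v. unfold regs_of, input.
  do 10 (destruct v as [|v]; [reflexivity|]). now destruct v.
Qed.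

Lemma sat_FNeg Q M (rho : nat -> M) f :
  sat Q M rho (FNeg f) <-> ~ sat Q M rho f.
Proof. reflexivity. Qed.

(** If the machine halts, the query fails in every model; otherwise the run satisfies it.
    Injectivity of [code] ensures that membership in [valid_codes] concerns this very formula. *)
Lemma valid_query_iff_halting Q xs ys glue link p k :
  two_point_prefix Q xs ys glue link ->
  0 < length p -> 0 < k -> Forall (fun ins => reg_of ins < k) p ->
  let C := conj (machine_clauses p k) in
  valid_codes Q (code (FNeg (query xs ys glue link C (code C)))) <->
  halting p (0, input (code C)).
Proof.
  (* The formula becomes a variable with an equation, so that its code stays unevaluated. *)
  intros P Hp Hk Hr C. generalize (eq_refl (FNeg (query xs ys glue link C (code C)))).
  generalize (FNeg (query xs ys glue link C (code C))) at 1 3. intros F EF.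
  split.
  - intros (F' & _ & E & V). apply code_inj in E. subst F' F.
    apply NNPP. intros N.
    destruct (nonhalting_query_sat Q xs ys glue link p k (code C) P N) as [rho S].
    exact (proj1 (sat_FNeg _ _ _ _) (V (nat * nat)%type (inhabits (0, 0)) rho) S).
  - intros H. exists F. split; [|split; [reflexivity|]]; subst F.
    + apply sentence_query; [exact P|apply wf_machine].
    + intros M _ rho. apply sat_FNeg.
      now apply (halting_query_unsat Q xs ys glue link p k).
Qed.

(* [enc] turns a number attached to a machine into the code [F p] of a
   sentence whose validity means that the machine halts on that number. *)
Lemma diagonal_not_recursive (V : nat -> Prop) (enc : program)
    (x F : program -> nat) :
  (forall p, 0 < length p -> V (F p) <-> halting p (0, input (x p))) ->
  (forall p, occurs_at p 0 enc ->
     star p (0, input (x p)) (length enc, input (F p))) ->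
  ~ recursive V.
Proof.
  intros Valid Run [q Hq]. set (n := length q).
  set (tail := [DEC 0 (length enc + n + 2); DEC 0 (length enc + n + 1)]).
  assert (Henc : occurs_at (diagonal enc q) 0 enc)
    by now exists [], (map (relocate (length enc) n) q ++ tail).
  assert (Hrest : occurs_at (diagonal enc q) (length enc)
                    (map (relocate (length enc) n) q ++ tail)).
  { exists enc, []. rewrite app_nil_r. now split. }
  assert (Hlen : length (diagonal enc q) = length enc + n + 2).
  { unfold diagonal. rewrite !length_app, length_map. cbn [length]. unfold n. lia. }
  set (p := diagonal enc q) in *. clearbody p.
  apply occurs_at_app in Hrest. destruct Hrest as [Hmid Hend].
  rewrite length_map in Hend. fold n in Hend.
  apply occurs_at_cons in Hend. destruct Hend as [E0 Hend].
  apply occurs_at_cons in Hend. destruct Hend as [E1 _].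
  (* The encoder is the same for all machines, so [p] can contain it and still be the machine it is
     applied to: self-reference comes from the input, not from a fixed point. *)
  specialize (Valid p ltac:(lia)).
  destruct (Hq (F p)) as (fuel & regs & R & HD).
  apply run_reach in R. destruct R as (pc & R & HN).
  apply step_None in HN.
  apply (relocate_star p (length enc) q _ _ Hmid) in R. cbn [fst snd] in R.
  (* A halted [q] has its counter at or past [n], so the relocated run stops exactly at the first of
     the two final instructions. *)
  rewrite Nat.min_l, Nat.add_0_r, Nat.min_r in R by lia.
  fold n in R.
  pose proof (star_trans _ _ _ _ (Run p Henc) R) as S2.
  (* Answer 1 claims that [p] halts, yet [p] enters the self-loop; answer 0 denies it, yet [p] jumps
     past its end. *)
  destruct HD as [[HV D]|[HV D]].
  - apply Valid in HV. apply (halting_star _ _ _ S2) in HV.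
    eapply halting_step in HV; [|unfold step; rewrite E0, D; reflexivity].
    revert HV.
    apply self_loop_not_halting. unfold step. rewrite E1.
    cbn [Nat.eqb]. now rewrite Nat.add_1_r.
  - apply HV, Valid. exists (length enc + n + 2), regs. split.
    + eapply star_trans; [exact S2|]. apply star_step. unfold step.
      now rewrite E0, D.
    + apply step_None. lia.
Qed.

Definition register_bound (p : program) : nat := S (list_max (map reg_of p)).

Lemma register_bound_spec p : Forall (fun ins => reg_of ins < register_bound p) p.
Proof.
  assert (H : Forall (fun r => r <= list_max (map reg_of p)) (map reg_of p))
    by now apply list_max_le.
  rewrite Forall_map in H. eapply Forall_impl; [|exact H].
  intros ins Hins. cbv beta in Hins. unfold register_bound. lia.
Qed.

Lemma two_point_prefix_undecidable Q xs ys glue link :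
  two_point_prefix Q xs ys glue link -> undecidable Q.
Proof.
  intros P.
  set (C := fun p => conj (machine_clauses p (register_bound p))).
  apply (diagonal_not_recursive (valid_codes Q)
    (compile 0 (ENCODE (pair (code_list xs) (code_list ys)) (code glue) (code link)))
    (fun p => code (C p))
    (fun p => code (FNeg (query xs ys glue link (C p) (code (C p)))))).
  - intros p Hp. apply valid_query_iff_halting; auto.
    + apply Nat.lt_0_succ.
    + apply register_bound_spec.
  - intros p Henc. rewrite <- !regs_of_input.
    exact (compile_correct _ _ _ (exec_ENCODE xs ys glue link (C p)) eq_refl p 0 Henc).
Qed.

Theorem mainTheorem1 :
  exists n : nat, undecidable (Hq n) /\ undecidable (Eq_ n).
Proof.
  (* Twelve functions at two points account for the 24 rows of [Hq 24]; [Eq_ 24] offers 24 functions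
     in each of its two rows. *)
  exists 24. split.
  - exact (two_point_prefix_undecidable _ _ _ _ _ H_prefix).
  - exact (two_point_prefix_undecidable _ _ _ _ _ E_prefix).
Qed.
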